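(* Let $M_1$ and $M_2$ be reachable markings of a t-net, both clean, and let $R_1\in\mathit{repr}(M_1)$, $R_2\in\mathit{repr}(M_2)$. Then $R_1\sim R_2$ (equivalence of sibling ordered pid-trees) if and only if $M_1\sim M_2$ (state equivalence).
   Context: Process identifiers (pids). $\mathbb{P}=(\mathbb{N}^+)^*$ is the set of finite tuples of positive integers, including $\langle\rangle$, under concatenation; $\langle a_1,\dots,a_n\rangle$ is written $a_1.\cdots.a_n$. For $\pi=\langle a_1,\dots,a_n\rangle$: $\mathit{length}(\pi)=n$; $\mathit{prefix}(\pi)=\langle a_1,\dots,a_{n-1}\rangle$ if $n>0$, else $\langle\rangle$; $\mathit{subpid}(\pi)=\{\pi\}\cup\mathit{subpid}(\mathit{prefix}(\pi))$ if $n>0$, $\emptyset$ if $n=0$. Relations: $\pi\sphericalangle_1\pi'$ iff $\pi'=\pi.a$ for some $a\in\mathbb N^+$; $\pi\sphericalangle\pi'$ iff $\pi'=\pi.a_1.\cdots.a_n$ for some $n\ge1$; $\pi\pitchfork_1\pi'$ iff $\pi=\pi''.i$, $\pi'=\pi''.(i+1)$ with $\pi''\ne\langle\rangle$; $\pi\pitchfork\pi'$ iff $\pi=\pi''.i$, $\pi'=\pi''.j$ with $\pi''\ne\langle\rangle$, $i<j$. $\mathbb P$ is ordered hierarchically: by length, then lexicographically. Coloured Petri nets and t-nets. Fix data values $\mathbb D\supseteq\mathbb N$ (disjoint from $\mathbb P$), variables $\mathbb V$, expressions $\mathbb E\supseteq\mathbb V\cup\mathbb D$; bindings are partial maps $\beta:\mathbb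 V\to\mathbb P\cup\mathbb D$ extended to expressions. A Petri net $(S,T,\ell)$ has finite disjoint places and transitions, place types $\ell(s)=X_1\times\dots\times X_k$ ($X_i\in\{\mathbb P,\mathbb D\}$), guards $\ell(t)\in\mathbb E$, arc labels $\ell(x,y)$ multisets over $\mathbb E$. A marking maps places to multisets of tokens of their type; $M\xrightarrow{t,\beta}M'$ iff $M(s)\ge\beta(\ell(s,t))$, $\beta(\ell(t,s))$ has type $\ell(s)$, $M'(s)=M(s)-\beta(\ell(s,t))+\beta(\ell(t,s))$ for all $s$, and $\beta(\ell(t))$ holds. A t-net additionally has: a unique generator place $s_\eta$ of type $\mathbb P\times\mathbb N$; initial marking with $M_0(s_\eta)=\{\langle\langle1\rangle,0\rangle\}$, other places empty or containing only data; for each $t$, $\ell(s_\eta,t)=\{\langle p_i,c_i\rangle:1\le i\le k\}$ (distinct variables) and $\ell(t,s_\eta)=\{\langle p_i,c_i+n_i\rangle:1\le i\le m\}\cup\{\langle p_i.(c_i+j),0\rangle:1\le i\le k,1\le j\le n_i\}$ ($m\le k$, $n_i\ge0$), $\Pi_t$ being the set of the $p_i.(c_i+j)$; arcs from $s\ne s_\eta$ carry vectors of variables and data values; arcs to $s\ne s_\eta$ carry vectors of expressions over data variables/values and elements of $\Pi_t\cup\{p_1,\dots,p_m\}$; guards are computable Boolean expressions over adjacent-arc variables and data values in which pids from $\Pi_t\cup\{p_1,\dots,p_k\}$ are only compared using $=,\sphericalangle_1,\sphericalangle,\pitchfork_1,\pitchfork$. Reachable markings are reached from $M_0$ by finitely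 many firings. States and state equivalence. For reachable $M$: $\sigma_M$ is the restriction of $M$ to places other than $s_\eta$; $\eta_M=\{\pi\mapsto k:\langle\pi,k\rangle\in M(s_\eta)\}$; $\mathit{next}_M(\pi)=\pi.(\eta_M(\pi)+1)$ for $\pi\in\mathrm{dom}(\eta_M)$; $\mathit{nextpid}_M=\{\mathit{next}_M(\pi):\pi\in\mathrm{dom}(\eta_M)\}$; $\mathit{pid}_M$ is the set of pids occurring in tokens of $M$ in any place (including $s_\eta$), the active pids. $M$ is clean if for every $\pi\in\mathit{pid}_M\cup\mathit{nextpid}_M$ with $\pi\ne\langle1\rangle$, $\mathit{prefix}(\pi)\in\mathit{pid}_M$. $M\sim_h M'$ iff $h:\mathit{pid}_M\cup\mathit{nextpid}_M\to\mathit{pid}_{M'}\cup\mathit{nextpid}_{M'}$ is a bijection with: (1) $h(\mathrm{dom}(\eta_M))=\mathrm{dom}(\eta_{M'})$; (2) $h(\mathit{next}_M(\pi))=\mathit{next}_{M'}(h(\pi))$ for $\pi\in\mathrm{dom}(\eta_M)$; (3) for $\prec\in\{\sphericalangle_1,\sphericalangle\}$, $\pi,\pi'\in\mathit{pid}_M$: $\pi\prec\pi'$ iff $h(\pi)\prec h(\pi')$; (4) for $\curlywedge\in\{\pitchfork_1,\pitchfork\}$, $\pi,\pi'\in\mathit{pid}_M\cup\mathit{nextpid}_M$: $\pi\curlywedge\pi'$ iff $h(\pi)\curlywedge h(\pi')$; (5) $\sigma_{M'}$ is $\sigma_M$ with each pid $\pi$ replaced by $h(\pi)$. $M\sim M'$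 iff $M\sim_h M'$ for some $h$. Pid-trees. $\Xi$ is the least set with $\langle M,C\rangle\in\Xi$ for a marking $M$ and $C=\langle\langle a_1,t_1\rangle,\dots,\langle a_n,t_n\rangle\rangle$, $t_i\in\Xi$, $a_i\in\mathbb P\setminus\{\langle\rangle\}$, for $i\ne j$: $a_i\ne a_j$, $a_i\notin\mathit{subpid}(a_j)$, $a_j\notin\mathit{subpid}(a_i)$; written $M\xrightarrow{a_1,\dots,a_n}\langle t_1,\dots,t_n\rangle$, root marking $M_t$. Inclusion: $\langle M',\langle\langle a'_i,t'_i\rangle\rangle_{i\le m}\rangle\subseteq\langle M,\langle\langle a_j,t_j\rangle\rangle_{j\le n}\rangle$ iff $M'\le M$ and each $i$ has $j$ with $a'_i=a_j$, $t'_i\subseteq t_j$. Subtrees: $\langle\langle\rangle,t_0\rangle\in\mathit{Trees}(t_0)$ and $\langle a_i.\pi',t\rangle\in\mathit{Trees}(t_0)$ if $\langle\pi',t\rangle\in\mathit{Trees}(t_i)$; $\mathit{pid}(t)=\{\pi:\langle\pi,t'\rangle\in\mathit{Trees}(t)\}$. Path labelled $\pi$ decorated by $M'$: pid-tree $t$ with $\pi\in\mathit{pid}(t)\subseteq\mathit{subpid}(\pi)\cup\{\langle\rangle\}$, $\langle\pi,\langle M',\langle\rangle\rangle\rangle\in\mathit{Trees}(t)$, all other markings empty; ''$R$ contains $\mathit{path}(\pi,M')$'' means such a path is $\subseteq R$; $\mathit{path}(\pi)=\mathit{path}(\pi,\emptyset)$. Relative path of nonempty $\pi\in\mathit{pid}(t)$,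 $t=M\xrightarrow{a_1,\dots,a_n}\langle t_1,\dots,t_n\rangle$: $\mathit{relpath}(\pi,t)=\langle i\rangle$ if $\pi=a_i$, and $\langle i\rangle$ followed by $\mathit{relpath}(\pi',t_i)$ if $\pi=a_i.\pi'$, $\pi'\ne\langle\rangle$; convention $\mathit{relpath}(\langle\rangle,t)=\langle\rangle$. Sibling ordered: $a_1\le\dots\le a_n$ (hierarchically) at every node. Representations. $\mathit{repr}(M)$: sibling ordered pid-trees $R$ built so that for each place $s$ of type $X_1\times\dots\times X_n$ and token $v=\langle x_1,\dots,x_n\rangle\in M(s)$ exactly one rule applies, and $R$ contains nothing beyond what the rules require (tokens with multiplicity): generator rule ($s=s_\eta$, $v=\langle\pi,i\rangle$): $R$ contains $\mathit{path}(\pi)$ and $\mathit{path}(\pi.(i+1))$; shared rule ($X_1=\mathbb D$): $R$ contains $\mathit{path}(\langle\rangle,\{(s,v)\})$ and $\mathit{path}(x_i)$ for every $X_i=\mathbb P$; owned rule ($X_1=\mathbb P$): $R$ contains $\mathit{path}(x_1,\{(s,v)\})$ and $\mathit{path}(x_i)$ for every $X_i=\mathbb P$. Pid-tree equivalence. For sibling ordered $T,T'$: $T\sim_h T'$ iff (1) $h=\{(\pi,\pi'):\pi\in\mathit{pid}(T),\pi'\in\mathit{pid}(T'),\mathit{relpath}(\pi,T)=\mathit{relpath}(\pi',T')\}$ is a bijection $\mathit{pid}(T)\to\mathit{pid}(T')$; (2) for all $\langle\pi,t\rangle\in\mathit{Trees}(T)$, $\langle h(\pi),t'\rangle\in\mathit{Trees}(T')$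 with $t=M_t\xrightarrow{a_1,\dots,a_n}\langle\dots\rangle$, $t'=M_{t'}\xrightarrow{a'_1,\dots,a'_{n'}}\langle\dots\rangle$: (a) $n=n'$; (b) for each $s\ne s_\eta$, $M_{t'}(s)$ is $M_t(s)$ with every pid $\rho$ replaced by $h(\rho)$; (c) for each $i$, $\mathit{length}(a_i)=\mathit{length}(a'_i)=1$ or both $>1$; (d) for each $1\le i<n$ with $\mathit{prefix}(a_i)=\mathit{prefix}(a_{i+1})$: $\mathit{prefix}(a'_i)=\mathit{prefix}(a'_{i+1})$ and, with $x,y,x',y'$ the last components of $a_i,a_{i+1},a'_i,a'_{i+1}$, either $y-x=y'-x'=1$ or $y-x>1$ and $y'-x'>1$. $T\sim T'$ iff $T\sim_h T'$ for some $h$. *)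

(* Defs.v *)
From HB Require Import structures.
From mathcomp Require Import all_boot all_order.
From mathcomp Require Import finmap multiset.
From mathcomp Require Import boolp classical_sets functions.
From Stdlib Require List.

Set Implicit Arguments.
Unset Strict Implicit.
Unset Printing Implicit Defensive.

Local Open Scope nat_scope.

(** * Process identifiers *)

Notation posnat := {n : nat | 0 < n}.

Definition posS (k : nat) : posnat := exist _ k.+1 isT.

Notation pid := (seq posnat).

Definition pid_one : pid := [:: posS 0].

Definition pid_prefix (p : pid) : pid := take (size p).-1 p.

(* The last component of p, with the dummy value 0 for the empty pid. *)
Definition pid_last (p : pid) : nat := last 0 (map val p).

Definition subpid (p : pid) : seq pid := [seq take i p | i <- iota 1 (size p)].

Definition pid_parent1 (p q : pid) : bool :=
  (0 < size q) && (p == pid_prefix q).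

(* [prefix] is the library's prefix order on sequences. *)
Definition pid_parent (p q : pid) : bool := prefix p q && (p != q).

(* Since the common prefix is nonempty, so are p and q. *)
Definition pid_siblings (r : rel nat) (p q : pid) : bool :=
  [&& pid_prefix p == pid_prefix q, pid_prefix p != [::]
    & r (pid_last p) (pid_last q)].

Definition pid_sibling1 : rel pid := pid_siblings (fun i j => j == i.+1).
Definition pid_sibling : rel pid := pid_siblings ltn.

Definition pid_le (p q : pid) : bool :=
  (size p < size q) ||
  ((size p == size q) && (map val p <= map val q :> seqlexi nat)%O).

(** * Values and tokens *)

(* The data values are the naturals together with a set O of other values. *)
Notation data O := (nat + O)%type.

Notation value O := (pid + data O)%type.
Notation token O := (seq (value O)).

Definition pidv (O : choiceType) (p : pid) : value O := inl p.
Definition datv (O : choiceType) (d : data O) : value O := inr d.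
Definition natv (O : choiceType) (n : nat) : value O := inr (inl n).

Inductive sort := SPid | SData | SNat.

Definition sort_eqb (k1 k2 : sort) : bool :=
  match k1, k2 with
  | SPid, SPid | SData, SData | SNat, SNat => true
  | _, _ => false
  end.

Lemma sort_eqP : Equality.axiom sort_eqb.
Proof. by case; case; constructor. Qed.

HB.instance Definition _ := hasDecEq.Build sort sort_eqP.

Definition has_sort (O : choiceType) (k : sort) (v : value O) : bool :=
  match k, v with
  | SPid, inl _ | SData, inr _ | SNat, inr (inl _) => true
  | _, _ => false
  end.

Definition has_type (O : choiceType) (ty : seq sort) (tok : token O) : bool :=
  all2 (@has_sort O) ty tok.

Definition map_pid (O : choiceType) (h : pid -> pid) (tok : token O)
    : token O :=
  [seq (if v is inl p then inl (h p) else v) | v <- tok].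

Definition mset_map (K L : choiceType) (f : K -> L) (A : {mset K}%mset)
    : {mset L}%mset :=
  seq_mset [seq f x | x <- A].

(** * Expressions and guards *)

Section Expressions.

Variables (O : choiceType) (V : eqType).

(* [EFun f xs] is a data expression over the variables xs: it is defined only
   when they are all bound to data values.  Data constants and nested
   operations are part of the (arbitrary, possibly partial) function f.
   [EChild p c j] is the pid p.(c+j). *)
Inductive expr :=
| EVar (x : V)
| EDat (d : data O)
| EFun (f : seq (data O) -> option (data O)) (xs : seq V)
| EPlus (c : V) (n : nat)
| EChild (p c : V) (j : nat).

Definition expr_vars (e : expr) : seq V :=
  match e with
  | EVar x => [:: x]
  | EDat _ => [::]
  | EFun _ xs => xs
  | EPlus c _ => [:: c]
  | EChild p c _ => [:: p; c]
  end.

Definition binding := V -> option (value O).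

Implicit Types b : binding.

Definition oseq (A : Type) (s : seq (option A)) : option (seq A) :=
  foldr (fun x acc => if x is Some a then omap (cons a) acc else None)
        (Some [::]) s.

Definition data_args b (xs : seq V) : option (seq (data O)) :=
  oseq [seq (if b x is Some (inr d) then Some d else None) | x <- xs].

Definition eval b (e : expr) : option (value O) :=
  match e with
  | EVar x => b x
  | EDat d => Some (datv d)
  | EFun f xs => omap (@datv O) (obind f (data_args b xs))
  | EPlus c n => if b c is Some (inr (inl k)) then Some (natv O (k + n)) else None
  | EChild p c j =>
      if (b p, b c) is (Some (inl q), Some (inr (inl k)))
      then omap (fun a : posnat => pidv O (rcons q a)) (insub (k + j))
      else None
  end.

(* A finite multiset of vectors of expressions, listed with multiplicities. *)
Definition label := seq (seq expr).

Definition eval_label b (l : label) : option (seq (token O)) :=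
  oseq [seq oseq [seq eval b e | e <- vec] | vec <- l].

Inductive pid_rel := REq | RParent1 | RParent | RSibling1 | RSibling.

Definition pid_rel_sem (r : pid_rel) : rel pid :=
  match r with
  | REq => fun p q => p == q
  | RParent1 => pid_parent1
  | RParent => pid_parent
  | RSibling1 => pid_sibling1
  | RSibling => pid_sibling
  end.

Inductive guard_expr :=
| GTrue
| GData (f : seq (data O) -> bool) (xs : seq V)
| GPid (r : pid_rel) (e1 e2 : expr)
| GNot (g : guard_expr)
| GAnd (g1 g2 : guard_expr).

(* [None] when the guard has no value under b; it then does not hold. *)
Fixpoint eval_guard b (g : guard_expr) : option bool :=
  match g with
  | GTrue => Some true
  | GData f xs => omap f (data_args b xs)
  | GPid r e1 e2 =>
      if (eval b e1, eval b e2) is (Some (inl p), Some (inl q))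
      then Some (pid_rel_sem r p q) else None
  | GNot g1 => omap negb (eval_guard b g1)
  | GAnd g1 g2 =>
      if (eval_guard b g1, eval_guard b g2) is (Some b1, Some b2)
      then Some (b1 && b2) else None
  end.

End Expressions.

(** * Coloured Petri nets *)

Record petri_net (O : choiceType) (V : eqType) := PetriNet {
  place : finType;
  trans : finType;
  place_type : place -> seq sort;
  guard : trans -> guard_expr O V;
  arc_in : place -> trans -> label O V;
  arc_out : trans -> place -> label O V
}.

Arguments place {O V} _.
Arguments trans {O V} _.
Arguments place_type {O V _} _.
Arguments guard {O V _} _.
Arguments arc_in {O V _} _ _.
Arguments arc_out {O V _} _ _.

Section PetriNets.

Variables (O : choiceType) (V : eqType) (N : petri_net O V).

Definition marking := {ffun place N -> {mset token O}%mset}.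

Implicit Types (M : marking) (s : place N) (t : trans N).

Definition typed M : bool :=
  [forall s, all (has_type (place_type s)) (M s)].

Definition mark0 : marking := [ffun=> mset0].

Definition mark_le M M' : bool := [forall s, (M s `<=` M' s)%mset].

(* k copies of the token v in the place s, and nothing else. *)
Definition mark_tok s (v : token O) (k : nat) : marking :=
  [ffun s' => if s' == s then msetn k v else mset0].

Definition fires M t (b : binding O V) M' : Prop :=
  exists (ins outs : place N -> seq (token O)),
    [/\ forall s, eval_label b (arc_in s t) = Some (ins s),
        forall s, eval_label b (arc_out t s) = Some (outs s),
        forall s, [/\ (seq_mset (ins s) `<=` M s)%mset,
                      all (has_type (place_type s)) (outs s) &
                      M' s = ((M s `\` seq_mset (ins s))
                                `+` seq_mset (outs s))%mset]
      & eval_guard b (guard t) = Some true].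

Inductive reachable_from M : marking -> Prop :=
| reach_refl : reachable_from M M
| reach_step M1 t b M2 :
    reachable_from M M1 -> fires M1 t b M2 -> reachable_from M M2.

Definition adjacent_var t (x : V) : Prop :=
  exists s vec e,
    [/\ List.In vec (arc_in s t) \/ List.In vec (arc_out t s),
        List.In e vec & x \in expr_vars e].

(* x stands at a data position of some input arc of t. *)
Definition data_var t (x : V) : Prop :=
  exists s vec i k,
    [/\ List.In vec (arc_in s t), onth vec i = Some (EVar O x),
        onth (place_type s) i = Some k & k != SPid].

Definition data_expr t (e : expr O V) : Prop :=
  match e with
  | EVar x => data_var t x
  | EDat _ | EFun _ _ | EPlus _ _ => True
  | EChild _ _ _ => False
  end.

End PetriNets.

Arguments mark0 {O V N}.

(** * T-nets *)

(* The i-th token <p_i, c_i> that a transition takes from the generator place,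
   and the number n_i of pids created as children of p_i. *)
Record gen_item (V : eqType) := GenItem {
  gpid : V;
  gcount : V;
  gnew : nat
}.

Section Generator.

Variables (O : choiceType) (V : eqType).

Implicit Types (its : seq (gen_item V)).

Definition new_pids its : seq (expr O V) :=
  flatten [seq [seq EChild O (gpid g) (gcount g) j | j <- iota 1 (gnew g)]
          | g <- its].

Definition gen_label_in its : label O V :=
  [seq [:: EVar O (gpid g); EVar O (gcount g)] | g <- its].

Definition gen_label_out its (m : nat) : label O V :=
  [seq [:: EVar O (gpid g); EPlus O (gcount g) (gnew g)] | g <- take m its]
  ++ [seq [:: e; EDat V (inl 0 : data O)] | e <- new_pids its].

Definition gen_token (p : pid) (k : nat) : token O :=
  [:: pidv O p; natv O k].

Fixpoint guard_ok (N : petri_net O V) (t : trans N) its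
    (g : guard_expr O V) : Prop :=
  let pid_operand e :=
    List.In e (new_pids its) \/ exists2 x, e = EVar O x & adjacent_var t x in
  match g with
  | GTrue => True
  | GData _ xs => forall x, x \in xs -> adjacent_var t x
  | GPid _ e1 e2 => pid_operand e1 /\ pid_operand e2
  | GNot g1 => guard_ok t its g1
  | GAnd g1 g2 => guard_ok t its g1 /\ guard_ok t its g2
  end.

End Generator.

Record tnet (O : choiceType) (V : eqType) := TNet {
  net :> petri_net O V;
  gen_place : place net;
  init_marking : marking net;
  gen_items : trans net -> seq (gen_item V);
  (* the first [gen_alive t] processes survive the firing of t *)
  gen_alive : trans net -> nat;
  tnet_gen_type : place_type gen_place = [:: SPid; SNat];
  tnet_place_type : forall s, s != gen_place ->
    place_type s != [::] /\ SNat \notin place_type s;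
  tnet_init_gen : init_marking gen_place = [mset gen_token O pid_one 0]%mset;
  tnet_init_typed : typed init_marking;
  tnet_init_data : forall s, s != gen_place ->
    forall tok v, tok \in init_marking s -> v \in tok -> has_sort SData v;
  tnet_gen_vars : forall t,
    uniq (map (@gpid V) (gen_items t) ++ map (@gcount V) (gen_items t));
  tnet_gen_alive : forall t, gen_alive t <= size (gen_items t);
  tnet_gen_in : forall t, arc_in gen_place t = gen_label_in O (gen_items t);
  tnet_gen_out : forall t,
    arc_out t gen_place = gen_label_out O (gen_items t) (gen_alive t);
  tnet_in : forall s t, s != gen_place ->
    forall vec e, List.In vec (arc_in s t) -> List.In e vec ->
      (exists x, e = EVar O x) \/ (exists d, e = EDat V d);
  tnet_out : forall s t, s != gen_place ->
    forall vec e, List.In vec (arc_out t s) -> List.In e vec ->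
      [\/ data_expr t e,
          List.In e (new_pids O (gen_items t)) |
          exists2 g, List.In g (take (gen_alive t) (gen_items t))
                   & e = EVar O (gpid g)];
  tnet_guard : forall t, guard_ok t (gen_items t) (guard t)
}.

Definition reachable (O : choiceType) (V : eqType) (N : tnet O V)
    (M : marking N) : Prop :=
  reachable_from (init_marking N) M.

(** * State equivalence *)

Section States.

Variables (O : choiceType) (V : eqType) (N : tnet O V).

Implicit Types (M : marking N) (p q : pid) (h : pid -> pid).

(* The graph of the partial map eta_M. *)
Definition eta M p (k : nat) : Prop := gen_token O p k \in M (gen_place N).

Definition eta_dom M : set pid := [set p | exists k, eta M p k].

(* The next pid of p when its counter is k. *)
Definition pid_next p (k : nat) : pid := rcons p (posS k).

Definition next_pids M : set pid :=
  [set q | exists p k, eta M p k /\ q = pid_next p k].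

Definition active_pids M : set pid :=
  [set p | exists s tok, tok \in M s /\ pidv O p \in tok].

Definition known_pids M : set pid := (active_pids M `|` next_pids M)%classic.

Definition clean M : Prop :=
  forall p, known_pids M p -> p <> pid_one -> active_pids M (pid_prefix p).

Definition state_equiv_by h M M' : Prop :=
  set_bij (known_pids M) (known_pids M') h /\
  [/\ (h @` eta_dom M)%classic = eta_dom M',
      forall p k k', eta M p k -> eta M' (h p) k' ->
        h (pid_next p k) = pid_next (h p) k',
      forall p q, active_pids M p -> active_pids M q ->
        pid_parent1 p q = pid_parent1 (h p) (h q) /\
        pid_parent p q = pid_parent (h p) (h q),
      forall p q, known_pids M p -> known_pids M q ->
        pid_sibling1 p q = pid_sibling1 (h p) (h q) /\
        pid_sibling p q = pid_sibling (h p) (h q)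
    & forall s, s != gen_place N -> M' s = mset_map (map_pid h) (M s)].

Definition state_equiv M M' : Prop := exists h, state_equiv_by h M M'.

End States.

(** * Pid-trees *)

Inductive tree (A : Type) := Tree of A & seq (pid * tree A).

Definition root (A : Type) (t : tree A) : A := let: Tree M _ := t in M.
Definition children (A : Type) (t : tree A) : seq (pid * tree A) :=
  let: Tree _ c := t in c.
Definition child_labels (A : Type) (t : tree A) : seq pid :=
  [seq x.1 | x <- children t].

Fixpoint subtrees (A : Type) (t : tree A) : seq (pid * tree A) :=
  let: Tree _ c := t in
  ([::], t) :: flatten [seq [seq (x.1 ++ y.1, y.2) | y <- subtrees x.2] | x <- c].

Definition tree_pids (A : Type) (t : tree A) : seq pid :=
  [seq x.1 | x <- subtrees t].

(* Only meaningful when p is in [tree_pids t], where t has prefix-free child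
   labels: at most one child label is then a prefix of p. *)
Fixpoint relpath (A : Type) (p : pid) (t : tree A) {struct t} : seq nat :=
  let: Tree _ c := t in
  if p == [::] then [::] else
  (fix go (i : nat) (c : seq (pid * tree A)) : seq nat :=
     match c with
     | [::] => [::]
     | (a, u) :: c' =>
         if prefix a p then i :: relpath (drop (size a) p) u else go i.+1 c'
     end) 1 c.

Fixpoint sibling_ordered (A : Type) (t : tree A) : bool :=
  let: Tree _ c := t in
  sorted pid_le [seq x.1 | x <- c] && all (fun x => sibling_ordered x.2) c.

Definition incomparable (a b : pid) : bool :=
  [&& a != b, a \notin subpid b & b \notin subpid a].

Section PidTrees.

Variables (O : choiceType) (V : eqType) (N : tnet O V).

Local Notation mtree := (tree (marking N)).

Implicit Types (M : marking N) (s : place N) (p : pid) (t R T : mtree).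

Fixpoint pid_tree t : bool :=
  let: Tree M c := t in
  [&& typed M,
      all (fun x => x.1 != [::]) c,
      pairwise incomparable [seq x.1 | x <- c]
    & all (fun x => pid_tree x.2) c].

Fixpoint tree_le t' t {struct t'} : bool :=
  let: Tree M' c' := t' in
  mark_le M' (root t) &&
  all (fun x => has (fun y => (x.1 == y.1) && tree_le x.2 y.2) (children t)) c'.

Definition is_path p M t : Prop :=
  [/\ pid_tree t,
      p \in tree_pids t /\ {subset tree_pids t <= [::] :: subpid p},
      List.In (p, Tree M [::]) (subtrees t)
    & forall q u, List.In (q, u) (subtrees t) -> q <> p -> root u = mark0].

Definition contains_path R p M : Prop :=
  exists2 t, is_path p M t & tree_le t R.

(* The rules are applied to all copies of a token at once: the path of a token
   v of s is decorated by as many copies of v as M holds in s. *)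
Inductive rule_satisfied M R s (v : token O) : Prop :=
| generator_rule p i of
    s = gen_place N & v = gen_token O p i &
    contains_path R p mark0 & contains_path R (pid_next p i) mark0
| shared_rule ty of
    s != gen_place N & place_type s = SData :: ty &
    contains_path R [::] (mark_tok s v (M s v)) &
    (forall p, pidv O p \in v -> contains_path R p mark0)
| owned_rule ty x v' of
    s != gen_place N & place_type s = SPid :: ty & v = pidv O x :: v' &
    contains_path R x (mark_tok s v (M s v)) &
    (forall p, pidv O p \in v -> contains_path R p mark0).

Definition rules_satisfied M R : Prop :=
  forall s v, v \in M s -> rule_satisfied M R s v.

(* Containing nothing beyond what the rules require is minimality with respect
   to the inclusion of pid-trees. *)
Definition representation M R : Prop :=
  [/\ pid_tree R, sibling_ordered R, rules_satisfied M R
    & forall R', pid_tree R' -> sibling_ordered R' -> rules_satisfied M R' ->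
        tree_le R' R -> R' = R].

Definition node_equiv (h : pid -> pid) T t t' : Prop :=
  let a i := nth [::] (child_labels t) i in
  let a' i := nth [::] (child_labels t') i in
  let n := size (children t) in
  [/\ n = size (children t'),
      forall s, s != gen_place N ->
        (* h is only defined on the pids of T *)
        (forall tok p, tok \in root t s -> pidv O p \in tok ->
           p \in tree_pids T) /\
        root t' s = mset_map (map_pid h) (root t s),
      forall i, i < n ->
        (size (a i) = 1 /\ size (a' i) = 1) \/
        (1 < size (a i) /\ 1 < size (a' i))
    & forall i, i.+1 < n -> pid_prefix (a i) = pid_prefix (a i.+1) ->
        pid_prefix (a' i) = pid_prefix (a' i.+1) /\
        let d := pid_last (a i.+1) - pid_last (a i) in
        let d' := pid_last (a' i.+1) - pid_last (a' i) in
        (d = 1 /\ d' = 1) \/ (1 < d /\ 1 < d')].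

Definition tree_equiv_by (h : pid -> pid) T T' : Prop :=
  [/\ forall p p', p \in tree_pids T -> p' \in tree_pids T' ->
        (h p = p' <-> relpath p T = relpath p' T'),
      set_bij [set` tree_pids T]%classic [set` tree_pids T']%classic h
    & forall p t t', List.In (p, t) (subtrees T) ->
        List.In (h p, t') (subtrees T') -> node_equiv h T t t'].

Definition tree_equiv T T' : Prop := exists h, tree_equiv_by h T T'.

End PidTrees.

(* Main.v *)
(** For a clean reachable marking the known pids (active or next), together with
    the empty pid, are closed under prefixes. As sibling labels of a pid-tree are
    incomparable, a tree satisfying the rules then has every known pid as a node
    reached by arcs of length 1; by minimality the representation is this tree,
    each node being decorated by the tokens it owns. Its relative paths are the
    sequences of sibling ranks, so a pid-tree equivalence is a bijection of the
    known pids that commutes with taking the parent and preserves the order and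
    the adjacency of siblings.

    What is left is to compare this with state equivalence. From left to right,
    the generators have to be recovered from the tree: the next pids are the
    leaves that occur in no token. From right to left, the root <1> must be
    preserved, which holds because it is the only active pid without an active
    parent. Both need invariants of reachable markings: the counter of a process
    is unique and bounds the index of all its active children, hence next pids
    are not active. *)

From mathcomp Require Import all_boot all_order.
From mathcomp Require Import finmap multiset.
From mathcomp Require Import boolp classical_sets.
From mathcomp Require Import zify.
From Stdlib Require List.
Require Import Defs.
From mathcomp Require Import eqtype choice.

Set Implicit Arguments.
Unset Strict Implicit.
Unset Printing Implicit Defensive.

Local Open Scope nat_scope.

(** * Membership in lists over types without decidable equality *)

Lemma In_mem (T : eqType) (x : T) (s : seq T) : List.In x s <-> x \in s.
Proof.
elim: s => //= y s IH; rewrite inE; split.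
  by case=> [->|/IH ->]; rewrite ?eqxx ?orbT.
by case/orP=> [/eqP->|/IH]; [left | right].
Qed.

Lemma In_map (S T : Type) (f : S -> T) (s : seq S) (y : T) :
  List.In y (map f s) <-> exists2 x, List.In x s & y = f x.
Proof.
rewrite List.in_map_iff; split; first by case=> x [<- ?]; exists x.
by case=> x ? ->; exists x.
Qed.

Lemma In_flatten_map (S T : Type) (f : S -> seq T) (s : seq S) (y : T) :
  List.In y (flatten (map f s)) <-> exists2 x, List.In x s & List.In y (f x).
Proof.
elim: s => [|z s IH] /=; first by split=> // -[].
rewrite List.in_app_iff IH; split.
  by case=> [?|[x ? ?]]; [exists z; [left|] | exists x; [right|]].
by case=> x [<-|xs] ?; [left | right; exists x].
Qed.

Lemma mem_map_In (S : Type) (T : eqType) (f : S -> T) (s : seq S) (y : T) :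
  y \in map f s <-> exists2 x, List.In x s & y = f x.
Proof. by rewrite -In_mem In_map. Qed.

Lemma allIn (S : Type) (P : pred S) (s : seq S) :
  reflect (forall x, List.In x s -> P x) (all P s).
Proof.
elim: s => [|y s IH] /=; first by constructor.
apply: (iffP andP) => [[Py /IH Ps] x [<-|/Ps]|H] //.
by split; [apply: H; left | apply/IH => x xs; apply: H; right].
Qed.

Lemma hasIn (S : Type) (P : pred S) (s : seq S) :
  reflect (exists2 x, List.In x s & P x) (has P s).
Proof.
elim: s => [|y s IH] /=; first by constructor=> -[].
apply: (iffP orP) => [[Py|/IH[x ? ?]]|[x [<-|xs] Px]].
- by exists y; [left|].
- by exists x; [right|].
- by left.
- by right; apply/IH; exists x.
Qed.

(** * Trees *)

Section Trees.

Variable A : Type.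
Implicit Types (t u : tree A) (c : seq (pid * tree A)) (p q : pid).

(** Trees are nested in the list of children, so the generated induction principle would give no
    hypothesis for them. *)
Lemma tree_nested_ind (P : tree A -> Prop) :
  (forall M c, (forall a t, List.In (a, t) c -> P t) -> P (Tree M c)) ->
  forall t, P t.
Proof.
move=> H; fix IH 1; case=> M c; apply: H.
elim: c => [|[b u] c IHc] a t /=; first by case.
by case=> [[_ <-]|]; [exact: IH | exact: IHc].
Qed.

Lemma in_subtrees p u (M : A) c :
  List.In (p, u) (subtrees (Tree M c)) <->
  p = [::] /\ u = Tree M c \/
  exists a t q, [/\ List.In (a, t) c, List.In (q, u) (subtrees t) & p = a ++ q].
Proof.
rewrite /= In_flatten_map; split.
  case=> [[<- <-]|[[a t] tc /In_map[[q v] vt [-> ->]]]]; first by left.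
  by right; exists a, t, q.
case=> [[-> ->]|[a [t [q [tc ut ->]]]]]; first by left.
by right; exists (a, t) => //; apply/In_map; exists (q, u).
Qed.

Lemma subtrees_root t : List.In ([::], t) (subtrees t).
Proof. by case: t => M c; left. Qed.

Lemma mem_tree_pids p t :
  p \in tree_pids t <-> exists u, List.In (p, u) (subtrees t).
Proof.
rewrite mem_map_In; split; first by case=> -[q u] ? ->; exists u.
by case=> u ?; exists (p, u).
Qed.

End Trees.

Lemma mem_subpid p q : (p \in subpid q) = prefix p q && (p != [::]).
Proof.
apply/mapP/andP=> [[i]|[pq p0]].
  rewrite mem_iota add1n ltnS => /andP[i0 iq] ->; split; first exact: prefix_take.
  by rewrite -size_eq0 size_takel // -lt0n.
exists (size p); last by apply/eqP; rewrite eq_sym -prefixE.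
by rewrite mem_iota add1n ltnS lt0n size_eq0 p0 size_prefix.
Qed.

Lemma incomparableE p q : p != [::] -> q != [::] ->
  incomparable p q = ~~ prefix p q && ~~ prefix q p.
Proof.
move=> p0 q0; rewrite /incomparable !mem_subpid p0 q0 !andbT.
by case: eqP => // ->; rewrite prefix_refl.
Qed.

(** * Nodes of trees with prefix-free child labels *)

Section PidTreeNodes.

Variables (O : choiceType) (V : eqType) (N : tnet O V).
Implicit Types (t u w : tree (marking N)) (p q a b : pid).

Lemma pid_tree_childP (M : marking N) c a t :
  pid_tree (Tree M c) -> List.In (a, t) c -> a != [::] /\ pid_tree t.
Proof.
move=> /= /and4P[_ /allIn an0 _ /allIn ct] atc.
by split; [apply: (an0 (a, t)) | apply: (ct (a, t))].
Qed.

Lemma pid_tree_child_inj (M : marking N) c a t b u :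
  pid_tree (Tree M c) -> List.In (a, t) c -> List.In (b, u) c ->
  prefix a b || prefix b a -> (a, t) = (b, u).
Proof.
move=> /= /and4P[_ + + _] tc uc ab.
elim: c tc uc => //= -[d v] c IH tc uc /andP[/= d0 /[dup] c0 /IH{}IH].
case/andP=> /allP dc /IH{}IH.
have dx x y : List.In (x, y) c -> prefix d x || prefix x d -> False.
  move=> xyc; have /allIn/(_ _ xyc)/= x0 := c0.
  have: incomparable d x by apply: dc; apply/mem_map_In; exists (x, y).
  by rewrite incomparableE // -negb_or => /negP.
case: tc uc ab => [[<- <-]|tc] [[<- <-]|uc] //.
- by move/(dx _ _ uc).
- by rewrite orbC => /(dx _ _ tc).
- by move=> _; apply: IH.
Qed.

(* The labels being prefix-free, the position of a node is determined by its
   pid. *)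
Lemma subtrees_cat t p q u w :
  pid_tree t -> List.In (p, u) (subtrees t) ->
  List.In (p ++ q, w) (subtrees t) -> List.In (q, w) (subtrees u).
Proof.
elim/tree_nested_ind: t p => M c IH p tree_c /in_subtrees[[-> ->]|] //.
case=> [a [t [p' [tc ut ->]]]] /in_subtrees[[/(congr1 size)]|].
  rewrite !size_cat; have [+ _] := pid_tree_childP tree_c tc.
  by rewrite -size_eq0 => /eqP a0 /eqP; rewrite !addn_eq0 => /andP[/andP[/eqP]].
case=> [b [v [q' [vc wv e]]]].
have [ea et] : (a, t) = (b, v).
  (* Both labels are prefixes of the same pid, so the shorter one is a prefix of the longer one. *)
  apply: pid_tree_child_inj tree_c tc vc _; rewrite -catA in e.
  have := congr1 (prefix a) e; rewrite prefix_prefix => /esym.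
  have [le|/ltnW le _] := leqP (size a) (size b).
    by rewrite !prefixE takel_cat // => ->.
  by apply/orP; right; rewrite prefixE -(takel_cat (p' ++ q) le) e take_size_cat.
subst b v; move/eqP: e; rewrite -catA eqseq_cat // eqxx /= => /eqP e.
have [_ tree_t] := pid_tree_childP tree_c tc.
by apply: IH tc _ tree_t ut _; rewrite e.
Qed.

Lemma subtrees_nil t u : pid_tree t -> List.In ([::], u) (subtrees t) -> u = t.
Proof.
case: t => M c tree_c /in_subtrees[[]|] // [[|x a] [t [q [tc ut //]]]].
by have [] := pid_tree_childP tree_c tc.
Qed.

Lemma pid_tree_subtree t p u :
  pid_tree t -> List.In (p, u) (subtrees t) -> pid_tree u.
Proof.
elim/tree_nested_ind: t p => M c IH p tree_c.
case/in_subtrees=> [[_ ->]|[a [t [q [tc ut _]]]]] //.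
exact: IH tc _ (proj2 (pid_tree_childP tree_c tc)) ut.
Qed.

Lemma subtrees_inj t p u w : pid_tree t -> List.In (p, u) (subtrees t) ->
  List.In (p, w) (subtrees t) -> u = w.
Proof.
move=> tree_t put pwt; apply/esym/subtrees_nil; first exact: pid_tree_subtree put.
by apply: subtrees_cat put _; rewrite ?cats0.
Qed.

(** A nonempty label that is a prefix of a single component is that component. So if the pids of the
    nodes are closed under prefixes, all arcs are forced to have length 1. *)
Lemma subtrees_child t p x u w : pid_tree t -> List.In (p, u) (subtrees t) ->
  List.In (rcons p x, w) (subtrees t) -> List.In ([:: x], w) (children u).
Proof.
rewrite -cats1 => tree_t put pwt; have tree_u := pid_tree_subtree tree_t put.
have := subtrees_cat tree_t put pwt; case: u tree_u {put} => M c tree_u.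
case/in_subtrees=> [[]|[[|y a] [v [q [tc wt [e]]]]]] //.
  by have [] := pid_tree_childP tree_u tc.
move=> /esym/nilP; rewrite /nilp size_cat addn_eq0 => /andP[/nilP a0 /nilP q0].
have [_ tree_t'] := pid_tree_childP tree_u tc.
by move: wt tc; rewrite {}a0 {}q0 e => /(subtrees_nil tree_t') ->.
Qed.

End PidTreeNodes.

(** * The tree of a finite prefix-closed set of pids *)

Section CanonicalTree.

Variable K : seq pid.

(** The components of the pids of [K] are a finite supply of candidates. Sorting makes the index of
    a component its rank among the siblings. *)
Definition kids (p : pid) : seq posnat :=
  path.sort (relpre val leq) [seq a <- undup (flatten K) | rcons p a \in K].

Lemma mem_kids p a : (a \in kids p) = (rcons p a \in K).
Proof.
rewrite mem_sort mem_filter mem_undup andb_idr // => paK.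
by apply/flattenP; exists (rcons p a); rewrite // mem_rcons mem_head.
Qed.

Lemma kids_uniq p : uniq (kids p).
Proof. by rewrite sort_uniq filter_uniq // undup_uniq. Qed.

Lemma kids_sorted p : sorted ltn (map val (kids p)).
Proof.
rewrite ltn_sorted_uniq_leq map_inj_uniq ?kids_uniq; last exact: val_inj.
by rewrite sorted_map sort_sorted // => x y; apply: leq_total.
Qed.

Lemma ltn_index_kids p a b : a \in kids p -> b \in kids p ->
  (index a (kids p) < index b (kids p)) = (val a < val b).
Proof.
move=> ap bp.
have H x y : x \in kids p -> y \in kids p ->
    index x (kids p) < index y (kids p) -> val x < val y.
  move=> xp yp; rewrite -!(index_map val_inj).
  by apply: (sorted_ltn_index ltn_trans (kids_sorted p)); apply: map_f.
apply/idP/idP=> [|ab]; first exact: H.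
rewrite ltnNge leq_eqVlt; apply/negP=> /orP[/eqP e|/(H _ _ bp ap)].
  by move: ab; rewrite -(nth_index a bp) e nth_index ?ltnn.
by rewrite ltnNge ltnW.
Qed.

Definition depth : nat := \max_(q <- K) size q.

Lemma size_le_depth p : p \in K -> size p <= depth.
Proof. by move=> pK; rewrite /depth (leq_bigmax_seq (F := size)). Qed.

(** Each extension within [K] lowers [depth - size p], so this is an induction from the leaves
    towards the root. *)
Lemma kids_ind (P : pid -> Prop) :
  (forall p, (forall a, rcons p a \in K -> P (rcons p a)) -> P p) ->
  forall p, P p.
Proof.
move=> H p; have [n] := ubnP (depth - size p).
elim: n p => // n IH p lt_n; apply: H => a /size_le_depth.
by rewrite size_rcons => lt_d; apply: IH; rewrite size_rcons subnSK.
Qed.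

(** The relative path of [q] below the node [p], computed from [K] alone. Ranks count from 1, as in
    [relpath]. *)
Fixpoint ranks (p q : pid) : seq nat :=
  if q is a :: q' then (index a (kids p)).+1 :: ranks (rcons p a) q' else [::].

Lemma ranks_rcons p q a :
  ranks p (rcons q a) = rcons (ranks p q) (index a (kids (p ++ q))).+1.
Proof.
elim: q p => [|b q IH] p /=; first by rewrite cats0.
by rewrite IH cat_rcons.
Qed.

(** * The tree with arcs of length 1 and with the pids of [K] as its nodes besides the root *)

Section Tree.

Variables (A : Type) (mk : pid -> A).

(** The fuel [n] makes the recursion structural, since extending a pid is no descent in a
    datatype. *)
Fixpoint grow (n : nat) (p : pid) : tree A :=
  Tree (mk p)
    (if n is n'.+1 then [seq ([:: a], grow n' (rcons p a)) | a <- kids p]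
     else [::]).

Definition ctree (p : pid) : tree A := grow (depth - size p) p.

(** The fuel runs out only at a node without kids: a kid there would give a pid of [K] longer than
    [depth]. *)
Lemma ctreeE p :
  ctree p = Tree (mk p) [seq ([:: a], ctree (rcons p a)) | a <- kids p].
Proof.
rewrite /ctree; case E: (depth - size p) => [|n] /=; congr Tree.
  case: (kids p) (mem_kids p) => // a s /(_ a); rewrite mem_head => /esym.
  by move/size_le_depth; rewrite size_rcons -subn_gt0 E.
by apply: eq_map => a; congr (_, grow _ _); rewrite size_rcons subnS E.
Qed.

Lemma root_ctree p : root (ctree p) = mk p.
Proof. by rewrite ctreeE. Qed.

Lemma child_labels_ctree p : child_labels (ctree p) = [seq [:: a] | a <- kids p].
Proof. by rewrite ctreeE /child_labels /= -map_comp. Qed.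

Lemma size_children_ctree p : size (children (ctree p)) = size (kids p).
Proof. by rewrite ctreeE size_map. Qed.

Lemma sibling_ordered_ctree p : sibling_ordered (ctree p).
Proof.
elim/kids_ind: p => p IH; rewrite ctreeE /= -map_comp; apply/andP; split.
  rewrite sorted_map; have := kids_sorted p; rewrite sorted_map.
  apply: sub_sorted => a b /= ab; rewrite /pid_le /=.
  by apply/andP; split; [exact: ltnW | rewrite implybT].
by rewrite all_map; apply/allP => a; rewrite mem_kids => /IH.
Qed.

Hypothesis K_closed : forall p a, rcons p a \in K -> p \in [::] :: K.

Lemma node_catl p q : p ++ q \in [::] :: K -> p \in [::] :: K.
Proof.
elim/last_ind: q => [|q a IH]; first by rewrite cats0.
rewrite -rcons_cat inE => /orP[|/K_closed/IH //].
by case: (p ++ q).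
Qed.

(** Closure under prefixes lets every extension of [p] in [K] be reached one component at a time. *)
Lemma in_subtrees_ctree p q u :
  List.In (q, u) (subtrees (ctree p)) <->
  u = ctree (p ++ q) /\ (q = [::] \/ p ++ q \in K).
Proof.
elim/kids_ind: p q u => p IH q u.
have -> : ctree p = Tree (mk p) [seq ([:: a], ctree (rcons p a)) | a <- kids p].
  exact: ctreeE.
rewrite in_subtrees; split.
  case=> [[-> ->]|[a [t [r [/In_map[b /In_mem + [-> ->]] + ->]]]]].
    by rewrite cats0 ctreeE; split=> //; left.
  rewrite mem_kids => bK /(IH _ bK)[->]; rewrite cat_rcons => pb; split=> //.
  by right; case: pb => // ->; rewrite cats1.
case: q => [|a q] [->]; first by rewrite cats0 -ctreeE; left.
rewrite -cat_rcons => -[//|paqK]; right.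
have paK : rcons p a \in K.
  have: rcons p a \in [::] :: K by apply: (@node_catl _ q); rewrite inE paqK orbT.
  by rewrite inE; case: eqP => // e; case: (p) e.
exists [:: a], (ctree (rcons p a)), q; split=> //.
  by apply/In_map; exists a => //; apply/In_mem; rewrite mem_kids.
by apply/IH => //; split=> //; right.
Qed.

Lemma tree_pids_ctree p : (p \in tree_pids (ctree [::])) = (p \in [::] :: K).
Proof.
apply/idP/idP=> [/mem_tree_pids[u /in_subtrees_ctree[_]]|].
  by rewrite inE => -[->|->]; rewrite ?orbT.
rewrite inE => pK; apply/mem_tree_pids; exists (ctree p).
by apply/in_subtrees_ctree; split=> //; case/orP: pK => [/eqP|]; [left | right].
Qed.

Lemma relpath_ctree p q : p ++ q \in K \/ q = [::] ->
  relpath q (ctree p) = ranks p q.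
Proof.
elim: q p => [|a q IH] p; first by rewrite ctreeE.
case=> // pqK; rewrite -cat_rcons in pqK.
have ap : a \in kids p.
  have: rcons p a \in [::] :: K by apply: (@node_catl _ q); rewrite inE pqK orbT.
  by rewrite inE mem_kids; case: eqP => // e; case: (p) e.
rewrite ctreeE /= -IH; last by left.
(* The loop over the siblings inside [relpath] is anonymous. It gets a name so that the induction
   can vary its list and its starting position. *)
match goal with |- ?go 1 _ = _ => set g := go end.
suff {ap} gE (s : seq posnat) k : a \in s ->
    g k [seq ([:: b], ctree (rcons p b)) | b <- s] =
    (k + index a s) :: relpath q (ctree (rcons p a)) by rewrite gE.
elim: s k => //= b s IHs k; rewrite inE eq_sym.
case: (eqVneq b a) => [->|] /= _; first by rewrite prefix0s drop0 addn0.
by move=> /IHs ->; rewrite addSnnS.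
Qed.

End Tree.

(** The last rank determines the last component among the kids of the parent, and the earlier ranks
    determine the parent by induction. A node can thus be identified by its relative path. *)
Lemma ranks_inj p q : [::] \notin K ->
  (forall p a, rcons p a \in K -> p \in [::] :: K) ->
  p \in [::] :: K -> q \in [::] :: K ->
  ranks [::] p = ranks [::] q -> p = q.
Proof.
move=> K0 Kc; elim/last_ind: p q => [|p a IH] q pK qK.
  by case: q {qK}.
case/lastP: q qK => [|q b] qK; first by rewrite ranks_rcons; case: ranks.
move: pK qK; rewrite !inE -!size_eq0 !size_rcons /= => pK qK.
rewrite !ranks_rcons => /rcons_inj[/IH e].
have {}e : p = q by apply: e; [exact: Kc pK | exact: Kc qK].
move: qK; rewrite -{}e -!mem_kids in pK * => qK e.
by congr rcons; apply: (index_inj a) e.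
Qed.

End CanonicalTree.

(** * Reachable markings *)

Lemma oseq_map_Some (T : Type) (s : seq T) : oseq (map Some s) = Some s.
Proof. by elim: s => //= x s ->. Qed.

Lemma oseqP (T : Type) (s : seq (option T)) (r : seq T) :
  oseq s = Some r <-> s = map Some r.
Proof.
split=> [|->]; last exact: oseq_map_Some.
elim: s r => [|[x|] s IH] r //=; first by case=> <-.
by case: oseq IH => //= r' IH [<-]; rewrite /= -IH.
Qed.

Lemma map_Some_In (S T : Type) (f : S -> option T) (s : seq S) (r : seq T) y :
  map f s = map Some r -> List.In y r -> exists2 x, List.In x s & f x = Some y.
Proof.
move=> e yr; have: List.In (Some y) (map Some r) by apply/In_map; exists y.
by rewrite -e => /In_map[x xs ->]; exists x.
Qed.

Lemma In_map_Some (S T : Type) (f : S -> option T) (s : seq S) (r : seq T) x :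
  map f s = map Some r -> List.In x s -> exists2 y, List.In y r & f x = Some y.
Proof.
move=> e xs; have: List.In (f x) (map f s) by apply/In_map; exists x.
by rewrite e => /In_map[y yr ->]; exists y.
Qed.

Lemma all2_onth (S T : Type) (r : S -> T -> bool) s t i x y :
  all2 r s t -> onth s i = Some x -> onth t i = Some y -> r x y.
Proof.
elim: s t i => [|a s IH] [|b t] [|i] //= /andP[rab rst].
  by case=> <- [<-].
exact: IH.
Qed.

Lemma uniq_map_In_inj (S : Type) (T : eqType) (f : S -> T) (s : seq S) x y :
  uniq (map f s) -> List.In x s -> List.In y s -> f x = f y -> x = y.
Proof.
elim: s => //= z s IH /andP[zs /IH{}IH] [<-|xs] [<-|ys] // e; last exact: IH.
- by case/negP: zs; rewrite e; apply/mem_map_In; exists y.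
- by case/negP: zs; rewrite -e; apply/mem_map_In; exists x.
Qed.

Lemma seq_mset_cat (T : choiceType) (s t : seq T) :
  seq_mset (s ++ t) = (seq_mset s `+` seq_mset t)%mset.
Proof. by apply/msetP => x; rewrite msetE2 !mset_seqE count_cat. Qed.

Lemma mem_seq_mset (T : choiceType) (s : seq T) : seq_mset s =i s.
Proof. by move=> x; rewrite in_mset mset_seqE -has_count has_pred1. Qed.

Lemma prefix_rcons2 (T : eqType) (p q : seq T) a x :
  prefix (rcons p a) (rcons q x) -> prefix (rcons p a) q \/ p = q /\ a = x.
Proof.
case/prefixP=> s; case/lastP: s => [|s y]; rewrite ?cats0 -?rcons_cat.
  by case/rcons_inj=> -> ->; right.
by case/rcons_inj=> -> _; left; apply: prefix_prefix.
Qed.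

Section Reachable.

Variables (O : choiceType) (V : eqType) (N : tnet O V).
Implicit Types (M : marking N) (p q : pid) (tok : token O) (g : gen_item V).

Local Notation gen := (gen_place N).

Lemma gen_typeP tok :
  has_type [:: SPid; SNat] tok -> exists p k, tok = gen_token O p k.
Proof.
case: tok => [|[p|//] [|[//|[k|//]] [|//]]] // _.
by exists p, k.
Qed.

Lemma pid_in_gen_token q p k : (pidv O q \in gen_token O p k) = (q == p).
Proof. by rewrite !inE orbF; apply/eqP/eqP => [[]|->]. Qed.

(* [inv_fresh] is about all descendants [q] of [p], because a child of [p] may
   disappear before its own children do. *)
Record net_invariant M : Prop := Invariant {
  inv_typed : typed M;
  inv_uniq : uniq [seq ohead tok | tok <- M gen];
  inv_root : forall q, active_pids M q -> prefix pid_one q;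
  inv_fresh : forall p k q (a : posnat),
    eta M p k -> active_pids M q -> prefix (rcons p a) q -> val a <= k
}.

Lemma typedP M s tok : typed M -> tok \in M s -> has_type (place_type s) tok.
Proof. by move=> /forallP/(_ s)/allP; apply. Qed.

Lemma eta_active M p k : eta M p k -> active_pids M p.
Proof. by move=> pk; exists gen, (gen_token O p k); rewrite mem_head. Qed.

Lemma inv_eta_inj M p k k' : net_invariant M -> eta M p k -> eta M p k' -> k = k'.
Proof.
case=> _ heads_uniq _ _ /In_mem pk /In_mem pk'.
by have [] := uniq_map_In_inj heads_uniq pk pk' erefl.
Qed.

Lemma inv_init : net_invariant (init_marking N).
Proof.
have gen0 p k : eta (init_marking N) p k -> p = pid_one /\ k = 0.
  by rewrite /eta tnet_init_gen in_mset1 => /eqP[-> ->].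
have act q : active_pids (init_marking N) q -> q = pid_one.
  case=> s [tok [tok_s q_tok]]; have [e|ns] := eqVneq s gen.
    move: tok_s q_tok; rewrite e tnet_init_gen in_mset1 => /eqP ->.
    by rewrite pid_in_gen_token => /eqP.
  by have := tnet_init_data ns tok_s q_tok.
split.
- exact: tnet_init_typed.
- by rewrite tnet_init_gen enum_msetn.
- by move=> q /act ->.
- by move=> p k q a /gen0[-> _] /act ->.
Qed.

(** * Preservation of the invariants by a single firing *)

Section Firing.

Variables (M : marking N) (t : trans N) (b : binding O V) (M' : marking N).
Hypothesis inv_M : net_invariant M.
Variables ins outs : place N -> seq (token O).
Hypothesis insE : forall s, eval_label b (arc_in s t) = Some (ins s).
Hypothesis outsE : forall s, eval_label b (arc_out t s) = Some (outs s).
Hypothesis step : forall s, [/\ (seq_mset (ins s) `<=` M s)%mset,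
  all (has_type (place_type s)) (outs s) &
  M' s = ((M s `\` seq_mset (ins s)) `+` seq_mset (outs s))%mset].

Let its := gen_items t.
(** The process and the counter bound by an item. The defaults make [P] and [C] total; [bind_items]
    shows that the items of [t] are bound to an actual pid and counter. *)
Let P g : pid := if b (gpid g) is Some (inl p) then p else [::].
Let C g : nat := if b (gcount g) is Some (inr (inl k)) then k else 0.
(** For [j > 0] this is the created pid p.(c+j): the predecessor cancels the successor in [posS]. *)
Let child g j : pid := rcons (P g) (posS (C g + j).-1).
Let rest := (M gen `\` seq_mset (ins gen))%mset.

Let ins_sub s : {subset ins s <= M s}.
Proof.
by move=> tok; rewrite -mem_seq_mset; apply: msubset_subset; have [] := step s.
Qed.

(** The token consumed for an item lies in the generator place of [M], whose type forces a pid
    followed by a natural number. *)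
Let bind_items g : List.In g its ->
  b (gpid g) = Some (inl (P g)) /\ b (gcount g) = Some (inr (inl (C g))).
Proof.
move=> g_its; have /oseqP := insE gen; rewrite tnet_gen_in -map_comp.
case/(In_map_Some (x := g)) => // tok /In_mem tok_in.
rewrite -[_ = _]/(oseq [:: b (gpid g); b (gcount g)] = Some tok) => /oseqP.
have /gen_typeP[p [k ->]] : has_type [:: SPid; SNat] tok.
  by rewrite -(tnet_gen_type N) (typedP (inv_typed inv_M)) // ins_sub.
by rewrite /P /C => -[-> ->].
Qed.

Let alive_items g : List.In g (take (gen_alive t) its) -> List.In g its.
Proof.
by rewrite -[X in _ -> List.In g X](cat_take_drop (gen_alive t)) List.in_app_iff; left.
Qed.

Let ins_gen : ins gen = [seq gen_token O (P g) (C g) | g <- its].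
Proof.
apply: (can_inj (f := Some) (g := odflt [::])) => //; rewrite -insE tnet_gen_in.
apply/oseqP; rewrite -!map_comp; apply: List.map_ext_in => g /bind_items[/= eP eC].
by rewrite eP eC.
Qed.

Let eval_child g j : List.In g its -> 0 < j ->
  eval b (EChild O (gpid g) (gcount g) j) = Some (pidv O (child g j)).
Proof.
case/bind_items=> /= -> -> j0; case: insubP => [a _ ea|]; last first.
  by rewrite addn_gt0 j0 orbT.
congr (Some (inl (rcons _ _))); apply: val_inj; rewrite ea /= prednK //.
by rewrite addn_gt0 j0 orbT.
Qed.

Let outs_gen : outs gen =
  [seq gen_token O (P g) (C g + gnew g) | g <- take (gen_alive t) its] ++
  flatten [seq [seq gen_token O (child g j) 0 | j <- iota 1 (gnew g)] | g <- its].
Proof.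
apply: (can_inj (f := Some) (g := odflt [::])) => //; rewrite -outsE tnet_gen_out.
apply/oseqP; rewrite !map_cat -!map_comp; congr (_ ++ _).
  apply: List.map_ext_in => g g_its /=.
  have /bind_items[-> ->] // : List.In g its.
  exact: alive_items.
rewrite !map_flatten -!map_comp; congr flatten; apply: List.map_ext_in => g g_its /=.
rewrite -!map_comp; apply/eq_in_map => j; rewrite mem_iota => /andP[j0 _].
by rewrite /= -/(eval b (EChild O (gpid g) (gcount g) j)) eval_child.
Qed.

Let new_pidP e q : List.In e (new_pids O its) -> eval b e = Some (inl q) ->
  exists g j, [/\ List.In g its, 0 < j <= gnew g & q = child g j].
Proof.
case/In_flatten_map=> g g_its /In_map[j /In_mem].
rewrite mem_iota add1n ltnS => jn ->; have /andP[j0 _] := jn.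
by rewrite eval_child // => -[<-]; exists g, j.
Qed.

Let eta_items g : List.In g its -> eta M (P g) (C g).
Proof.
move=> g_its; apply: ins_sub; rewrite ins_gen; apply/mem_map_In; by exists g.
Qed.

Let gen_old : perm_eq (M gen) (ins gen ++ rest).
Proof.
apply/eq_seq_msetP; rewrite seq_mset_cat !seq_mset_id.
by apply/esym/msetBDKC; have [] := step gen.
Qed.

Let gen_new : perm_eq (M' gen) (rest ++ outs gen).
Proof.
apply/eq_seq_msetP; rewrite seq_mset_cat !seq_mset_id.
by have [_ _ ->] := step gen.
Qed.

Let uniq_old : uniq ([seq ohead tok | tok <- ins gen] ++
                     [seq ohead tok | tok <- rest]).
Proof.
by rewrite -map_cat -(perm_uniq (perm_map _ gen_old)); case: inv_M.
Qed.

Let P_inj g g' : List.In g its -> List.In g' its -> P g = P g' -> g = g'.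
Proof.
move=> gi gi' e; move: uniq_old; rewrite cat_uniq => /andP[+ _].
rewrite ins_gen -map_comp => u; apply: (uniq_map_In_inj u gi gi').
by rewrite /= e.
Qed.

Let rest_neq p k g : List.In g its -> gen_token O p k \in rest -> p <> P g.
Proof.
move=> g_its pk e; move: uniq_old; rewrite cat_uniq => /and3P[_ /hasP[]].
exists (Some (pidv O p)); first by apply/mapP; exists (gen_token O p k).
rewrite ins_gen -map_comp; apply/mem_map_In; exists g => //=.
by rewrite e.
Qed.

Let rest_eta p k : gen_token O p k \in rest -> eta M p k.
Proof.
by move=> pk; rewrite /eta (perm_mem gen_old) mem_cat pk orbT.
Qed.

(** The output arcs carry only data expressions, surviving processes and newly created pids, so no
    other pid can appear. *)
Let active_new q : active_pids M' q -> active_pids M q \/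
  exists g j, [/\ List.In g its, 0 < j <= gnew g & q = child g j].
Proof.
case=> s [tok [+ q_tok]]; have [sub _ ->] := step s; rewrite in_msetD => /orP[].
  by rewrite in_msetB => lt; left; exists s, tok; rewrite in_mset (leq_trans _ lt).
rewrite mem_seq_mset => tok_out; have [e|ns] := eqVneq s gen.
  move: tok_out; rewrite e outs_gen mem_cat => /orP[].
    case/mem_map_In=> g g_its etok; left; move: q_tok; rewrite etok.
    rewrite pid_in_gen_token => /eqP ->.
    apply: (@eta_active _ _ (C g)); apply: eta_items.
    exact: alive_items.
  case/In_mem/In_flatten_map=> g g_its /In_map[j /In_mem].
  rewrite mem_iota add1n ltnS => jn etok; right; exists g, j; split=> //.
  by apply/eqP; rewrite -(pid_in_gen_token _ _ 0) -etok.
have [vec vec_out /oseqP evec] :=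
  map_Some_In (proj1 (oseqP _ _) (outsE s)) (proj2 (In_mem _ _) tok_out).
have [e e_vec ev] := map_Some_In evec (proj2 (In_mem _ _) q_tok).
case: (tnet_out ns vec_out e_vec) => [|/new_pidP H|[g g_its ee]]; last 2 first.
- by right; apply: H.
- left; apply: (@eta_active _ _ (C g)).
  have g_all : List.In g its.
    exact: alive_items.
  have [eP _] := bind_items g_all; have := eta_items g_all.
  by move: ev; rewrite ee /= eP => -[->].
case: e {e_vec} ev => [x|d|f xs|c n|] //=; last 2 first.
- by case: (obind f _).
- by case: (b c) => [[|[]]|].
(* A variable used as data stands at a data position of some input arc. The type of the token
   consumed there shows that its value is not a pid. *)
move=> bx [s' [vec' [i [k [vec_in vec_i ty_i kn]]]]].
have [tok' /In_mem tok_in /oseqP evec'] :=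
  In_map_Some (proj1 (oseqP _ _) (insE s')) vec_in.
have tok_ty := typedP (inv_typed inv_M) (ins_sub tok_in).
have : onth (map (eval b) vec') i = onth (map Some tok') i by rewrite evec'.
rewrite !onth_map vec_i /= bx; case tok_i: (onth tok' i) => [v|] // [ev].
by have := all2_onth tok_ty ty_i tok_i; rewrite -ev; case: k ty_i kn.
Qed.

Let eta_new p k : eta M' p k ->
  [\/ gen_token O p k \in rest,
      exists g, [/\ List.In g its, p = P g & k = C g + gnew g] |
      exists g j, [/\ List.In g its, 0 < j <= gnew g, p = child g j & k = 0]].
Proof.
rewrite /eta (perm_mem gen_new) !mem_cat outs_gen mem_cat => /or3P[|/mem_map_In|].
- by constructor 1.
- case=> g g_its [-> ->]; constructor 2; exists g; split=> //.
  exact: alive_items.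
- case/In_mem/In_flatten_map=> g g_its /In_map[j /In_mem].
  by rewrite mem_iota add1n ltnS => jn [-> ->]; constructor 3; exists g, j.
Qed.

(** The index [C g + j] exceeds the counter [C g], which bounds the first component below [P g] of
    every active descendant of [P g]. *)
Let child_fresh g j q : List.In g its -> 0 < j -> active_pids M q ->
  ~~ prefix (child g j) q.
Proof.
move=> g_its j0 q_act; apply/negP=> /(inv_fresh inv_M (eta_items g_its) q_act) /=.
by rewrite prednK ?addn_gt0 ?j0 ?orbT // -[X in _ <= X]addn0 leq_add2l leqNgt j0.
Qed.

Let child_inj g g' j j' : List.In g its -> List.In g' its -> 0 < j -> 0 < j' ->
  child g j = child g' j' -> g = g' /\ j = j'.
Proof.
move=> gi gi' j0 j0' /rcons_inj[/(P_inj gi gi') <- /(congr1 succn)].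
by rewrite !prednK ?addn_gt0 ?j0 ?j0' ?orbT // => /addnI.
Qed.

Let uniq_children (l : seq (gen_item V)) :
  (forall g, List.In g l -> List.In g its) -> uniq (map P l) ->
  uniq [seq child g j | g <- l, j <- iota 1 (gnew g)].
Proof.
elim: l => //= g l IH l_its /andP[gl /IH{}IH].
have g_its : List.In g its by apply: l_its; left.
rewrite cat_uniq IH ?andbT => [|g' g'l]; last by apply: l_its; right.
have iota0 n j : j \in iota 1 n -> 0 < j by rewrite mem_iota => /andP[].
apply/andP; split.
  rewrite map_inj_in_uniq ?iota_uniq // => j j' /iota0 j0 /iota0 j0' e.
  by have [] := child_inj g_its g_its j0 j0' e.
apply/hasPn => q /In_mem/In_flatten_map[g' g'l /In_map[j' /In_mem/iota0 j0' ->]].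
apply/negP=> /mapP[j /iota0 j0 e].
have g_its' : List.In g' its by apply: l_its; right.
have [eg _] := child_inj g_its' g_its j0' j0 e.
by case/negP: gl; apply/mem_map_In; exists g'; rewrite // eg.
Qed.

(** The surviving processes had distinct pids already; the created pids were not active before, and
    no two of them coincide. *)
Let uniq_new : uniq [seq ohead tok | tok <- M' gen].
Proof.
rewrite (perm_uniq (perm_map _ gen_new)) map_cat outs_gen map_cat catA cat_uniq.
have child_neq g j q : List.In g its -> 0 < j -> active_pids M q ->
    Some (pidv O q) <> Some (pidv O (child g j)).
  move=> g_its j0 q_act [e]; case/negP: (child_fresh g_its j0 q_act).
  by rewrite e prefix_refl.
apply/and3P; split.
- move: uniq_old; rewrite ins_gen uniq_catC; apply: subseq_uniq.
  by apply: cat_subseq => //; rewrite -!map_comp map_take; apply: take_subseq.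
- apply/hasPn => x /mapP[tok /In_mem/In_flatten_map[g g_its]].
  case/In_map=> j /In_mem; rewrite mem_iota => /andP[j0 _] -> -> {x tok}.
  rewrite mem_cat; apply/negP=> /orP[/mapP[tok tok_rest]|].
    have tokM : tok \in M gen by rewrite (perm_mem gen_old) mem_cat tok_rest orbT.
    have := typedP (inv_typed inv_M) tokM; rewrite tnet_gen_type.
    case/gen_typeP=> p [k etok]; rewrite etok => /esym /=.
    by apply: child_neq => //; apply: (@eta_active _ _ k); rewrite /eta -etok.
  rewrite -map_comp => /mem_map_In[g' g'l] /esym /=.
  apply: child_neq => //; apply: (@eta_active _ _ (C g')); apply: eta_items.
  exact: alive_items.
- rewrite map_flatten -map_comp.
  rewrite (_ : flatten _ = map (fun q => Some (pidv O q))
    [seq child g j | g <- its, j <- iota 1 (gnew g)]).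
    rewrite map_inj_uniq => [|p q []//]; apply: uniq_children => //.
    move: uniq_old; rewrite cat_uniq ins_gen -map_comp => /andP[+ _].
    rewrite -(map_inj_uniq (f := fun q => Some (pidv O q))) => [|p q []//].
    by rewrite -map_comp.
  rewrite map_flatten -map_comp; congr flatten; apply: eq_map => g /=.
  by rewrite -!map_comp.
Qed.

Lemma inv_fires : net_invariant M'.
Proof.
have [typed_M _ root_M fresh_M] := inv_M; split=> //.
- apply/forallP=> s; have [_ outs_s ->] := step s; apply/allP=> tok.
  rewrite in_msetD in_msetB mem_seq_mset => /orP[lt|]; last exact/allP.
  by apply: (typedP typed_M); rewrite in_mset (leq_trans _ lt).
- move=> q /active_new[/root_M //|[g [j [g_its _ ->]]]].
  apply: prefix_trans (prefix_rcons _ _).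
  exact: root_M (eta_active (eta_items g_its)).
(* The bound is checked for each origin of the generator [p] (left alone, taken with its counter
   raised, or created) against each origin of [q] (active before, or created). *)
- move=> p k q a /eta_new pk /active_new[q_act pq|].
    case: pk => [/rest_eta pk|[g [g_its ep ->]]|[g [j [g_its /andP[j0 _] ep _]]]].
    + exact: fresh_M pk q_act pq.
    + rewrite ep in pq; apply: leq_trans (leq_addr _ _).
      exact: fresh_M (eta_items g_its) q_act pq.
    + case/negP: (child_fresh g_its j0 q_act); rewrite -ep.
      exact: prefix_trans (prefix_rcons _ _) pq.
  (* A created [q] is a child of [P g']. Either [rcons p a] is already a prefix of the active pid
     [P g'], or [p] is [P g'] itself and [a] is the new index, which the raised counter covers since
     [j' <= gnew g']. *)
  case=> g' [j' [g_its' /andP[j0' jn'] ->]] /prefix_rcons2[pq|[ep ->]].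
    have P'_act := eta_active (eta_items g_its').
    case: pk => [/rest_eta pk|[g [g_its ep ->]]|[g [j [g_its /andP[j0 _] ep _]]]].
    + exact: fresh_M pk P'_act pq.
    + rewrite ep in pq; apply: leq_trans (leq_addr _ _).
      exact: fresh_M (eta_items g_its) P'_act pq.
    + case/negP: (child_fresh g_its j0 P'_act); rewrite -ep.
      exact: prefix_trans (prefix_rcons _ _) pq.
  case: pk => [pk|[g [g_its eg ->]]|[g [j [g_its /andP[j0 _] eg _]]]].
  + by case: (rest_neq g_its' pk).
  + have {}eg := P_inj g_its' g_its (etrans (esym ep) eg); rewrite -eg /=.
    by rewrite prednK ?leq_add2l // addn_gt0 j0' orbT.
  + have /negP[] := child_fresh g_its j0 (eta_active (eta_items g_its')).
    by rewrite -ep eg prefix_refl.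
Qed.

End Firing.

Lemma reachable_inv M : reachable M -> net_invariant M.
Proof.
elim=> [|M1 t b M2 _ inv1 [ins [outs [insE outsE step _]]]]; first exact: inv_init.
exact: (inv_fires inv1 insE outsE step).
Qed.

End Reachable.

(** * The representation of a clean reachable marking *)

Lemma pid_prefix_rcons (p : pid) a : pid_prefix (rcons p a) = p.
Proof. by rewrite /pid_prefix size_rcons -cats1 take_size_cat. Qed.

Lemma pid_last_rcons (p : pid) a : pid_last (rcons p a) = val a.
Proof. by rewrite /pid_last map_rcons last_rcons. Qed.

Section Representation.

Variables (O : choiceType) (V : eqType) (N : tnet O V).
Implicit Types (M D : marking N) (p q : pid) (tok : token O) (s : place N).
Implicit Types (t u w R : tree (marking N)).

Local Notation gen := (gen_place N).

Definition token_pids tok : seq pid :=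
  pmap (fun v => if v is inl p then Some p else None) tok.

Definition active_seq M : seq pid :=
  flatten [seq flatten [seq token_pids tok | tok <- M s] | s <- enum (place N)].

Definition next_seq M : seq pid :=
  pmap (fun tok => if tok is [:: inl p; inr (inl k)] then Some (pid_next p k)
                   else None) (M gen).

(** A finite enumeration of the known pids, to be used as the set [K] of nodes. *)
Definition known_seq M : seq pid := active_seq M ++ next_seq M.

Lemma mem_token_pids p tok : (p \in token_pids tok) = (pidv O p \in tok).
Proof. by elim: tok => //= -[q|d] tok IH; rewrite !inE -IH. Qed.

Lemma active_seqP M p : p \in active_seq M <-> active_pids M p.
Proof.
split=> [/flattenP[l /mapP[s _ ->] /flattenP[l' /mapP[tok tok_s ->]]]|].
  by rewrite mem_token_pids; exists s, tok.
case=> s [tok [tok_s p_tok]]; apply/flattenP.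
exists (flatten [seq token_pids tok | tok <- M s]).
  by apply: map_f; rewrite mem_enum.
apply/flattenP; exists (token_pids tok); first exact: map_f.
by rewrite mem_token_pids.
Qed.

Lemma next_seqP M p : p \in next_seq M <-> next_pids M p.
Proof.
rewrite mem_pmap; split=> [/mapP[tok tok_gen]|[q [k [qk ->]]]].
  case: tok tok_gen => [|[q|//] [|[//|[k|//]] [|//]]] // tok_gen [->].
  by exists q, k.
by apply/mapP; exists (gen_token O q k).
Qed.

Lemma known_seqP M p : p \in known_seq M <-> known_pids M p.
Proof.
rewrite mem_cat; split.
  by case/orP=> [/active_seqP|/next_seqP]; [left | right].
by case=> [/active_seqP|/next_seqP] ->; rewrite ?orbT.
Qed.

Lemma known_root M p : net_invariant M -> known_pids M p -> prefix pid_one p.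
Proof.
move=> inv_M [/(inv_root inv_M) //|[q [k [/eta_active/(inv_root inv_M) q1 ->]]]].
exact: prefix_trans q1 (prefix_rcons _ _).
Qed.

Lemma known_nonnil M : net_invariant M -> [::] \notin known_seq M.
Proof. by move=> inv_M; apply/negP=> /known_seqP/(known_root inv_M). Qed.

Lemma known_parent M p a : net_invariant M -> clean M ->
  known_pids M (rcons p a) -> p <> [::] -> active_pids M p.
Proof.
move=> inv_M clean_M pa p0; rewrite -(pid_prefix_rcons p a); apply: clean_M => //.
by rewrite -[pid_one]/(rcons [::] _) => /rcons_inj[].
Qed.

Lemma known_closed M p a : net_invariant M -> clean M ->
  rcons p a \in known_seq M -> p \in [::] :: known_seq M.
Proof.
move=> inv_M clean_M /known_seqP pa; rewrite inE; have [//|/eqP p0] := eqVneq p [::].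
by apply/known_seqP; left; apply: known_parent pa p0.
Qed.

(** The node that the shared and owned rules decorate with the token. The value [[::]] is the root,
    where shared tokens go. *)
Definition owner s tok : pid :=
  if (place_type s, tok) is (SPid :: _, inl x :: _) then x else [::].

(** The generator rule asks only for undecorated paths, so generator tokens appear at no node. *)
Definition node_mark M p : marking N :=
  [ffun s => if s == gen then mset0
             else seq_mset [seq tok <- M s | owner s tok == p]].

Lemma node_markE M p s tok : s != gen ->
  node_mark M p s tok = if owner s tok == p then M s tok else 0.
Proof.
move=> /negPf ns; rewrite ffunE ns mset_seqE count_filter -count_mem_mset.
case: eqP => e; first by apply: eq_count => v /=; case: eqP => //= ->; rewrite e eqxx.
apply/eqP; rewrite -leqn0 leqNgt -has_count; apply/hasPn => v _ /=.
by apply/negP=> /andP[/eqP -> /eqP].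
Qed.

Lemma mem_node_mark M p s tok : s != gen ->
  (tok \in node_mark M p s) = (owner s tok == p) && (tok \in M s).
Proof. by move=> ns; rewrite !in_mset node_markE //; case: eqP. Qed.

Lemma typed_node_mark M p : typed M -> typed (node_mark M p).
Proof.
move=> typed_M; apply/forallP=> s; apply/allP=> tok; rewrite ffunE.
case: eqP => _; first by rewrite enum_mset0.
rewrite (perm_mem (perm_eq_seq_mset _)) mem_filter => /andP[_].
exact: typedP.
Qed.

Lemma typed_mark0 : typed (mark0 : marking N).
Proof. by apply/forallP=> s; rewrite ffunE enum_mset0. Qed.

Lemma typed_mark_tok M s tok : typed M -> typed (mark_tok s tok (M s tok)).
Proof.
move=> typed_M; apply/forallP=> s'; apply/allP=> v; rewrite ffunE.
case: eqP => [->|_]; last by rewrite enum_mset0.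
rewrite enum_msetn => /nseqP[-> tok_s].
by apply: typedP typed_M _; rewrite in_mset.
Qed.

Lemma mark0_le M : mark_le mark0 M.
Proof. by apply/forallP=> s; rewrite ffunE msub0set. Qed.

Lemma mark_le_tok s tok k M : k <= M s tok -> mark_le (mark_tok s tok k) M.
Proof.
move=> le_k; apply/forallP=> s'; rewrite ffunE; case: eqP => [->|_].
  by apply/msubsetP => v; rewrite msetnE; case: eqP => // ->.
exact: msub0set.
Qed.

Lemma mark_tok_le s tok k M : mark_le (mark_tok s tok k) M -> k <= M s tok.
Proof. by move=> /forallP/(_ s)/msubsetP/(_ tok); rewrite ffunE eqxx msetnxx. Qed.

Lemma tree_leP M c t : reflect
  (mark_le M (root t) /\ forall a u, List.In (a, u) c ->
     exists2 w, List.In (a, w) (children t) & tree_le u w)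
  (tree_le (Tree M c) t).
Proof.
apply: (iffP andP) => -[le_M H]; split=> //.
  move=> a u uc; move/allIn/(_ _ uc)/hasIn: H => [[b w] wt /andP[/eqP /= -> ?]].
  by exists w.
apply/allIn => -[a u] /H[w wt uw]; apply/hasIn; exists (a, w) => //=.
by rewrite eqxx.
Qed.

Lemma tree_le_subtree t R p u : tree_le t R -> List.In (p, u) (subtrees t) ->
  exists2 w, List.In (p, w) (subtrees R) & mark_le (root u) (root w).
Proof.
elim/tree_nested_ind: t R p => M c IH R p /tree_leP[le_M le_c].
case/in_subtrees=> [[-> ->]|[a [t [q [tc ut ->]]]]].
  by exists R => //; apply: subtrees_root.
have [w wR tw] := le_c _ _ tc; have [v vw uv] := IH _ _ tc _ _ tw ut.
exists v => //; case: R wR {le_M le_c} => M' c' wR.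
by apply/in_subtrees; right; exists a, w, q.
Qed.

Lemma contains_path_subtree R p D : contains_path R p D ->
  exists2 w, List.In (p, w) (subtrees R) & mark_le D (root w).
Proof. by case=> t [_ _ pt _] /tree_le_subtree/(_ pt). Qed.

(** Among the paths labelled [p], the one with all arcs of length 1. It is the one that fits into a
    tree whose labels have length 1. *)
Fixpoint chain (p : pid) D : tree (marking N) :=
  if p is a :: p' then Tree mark0 [:: ([:: a], chain p' D)] else Tree D [::].

Lemma in_subtrees_chain p D q u :
  List.In (q, u) (subtrees (chain p D)) <->
  exists2 r, p = q ++ r & u = chain r D.
Proof.
elim: p q u => [|a p IH] q u; rewrite [chain _ _]/=.
  rewrite in_subtrees; split=> [[[-> ->]|[a [t [r [[]]]]]]|[r e ->]].
    by exists [::].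
  by left; case: q r e => [|x q] [|y r].
rewrite in_subtrees; split.
  case=> [[-> ->]|[b [t [r [[[<- <-]|[]]]]]]]; first by exists (a :: p).
  by move=> /IH[r' -> ->] ->; exists r'.
case=> r; case: q => [|x q] /= => [<- ->|[<- e] ->]; first by left.
by right; exists [:: a], (chain p D), q; split=> //; [left | apply/IH; exists r].
Qed.

Lemma is_path_chain p D : typed D -> is_path p D (chain p D).
Proof.
move=> typed_D; split.
- by elim: p => [|a p IH] /=; rewrite ?typed_D // typed_mark0 IH.
- split.
    by apply/mem_tree_pids; exists (chain [::] D); apply/in_subtrees_chain;
      exists [::]; rewrite ?cats0.
  move=> q /mem_tree_pids[u /in_subtrees_chain[r -> _]].
  by rewrite inE mem_subpid prefix_prefix; case: q.
- by apply/in_subtrees_chain; exists [::]; rewrite ?cats0.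
- move=> q u /in_subtrees_chain[[|a r] -> -> //].
  by rewrite cats0.
Qed.

(** * Inclusion of paths in the tree on [K], and of this tree in other pid-trees *)

Section Tree.

Variables (K : seq pid) (mk : pid -> marking N).
Hypothesis K_closed : forall p a, rcons p a \in K -> p \in [::] :: K.

Lemma pid_tree_ctree p : (forall q, typed (mk q)) -> pid_tree (ctree K mk p).
Proof.
move=> typed_mk; elim/(kids_ind (K := K)): p => p IH; rewrite ctreeE /= typed_mk /=.
apply/and3P; split.
- by rewrite all_map; apply/allP.
- rewrite -map_comp; have := kids_uniq K p; rewrite uniq_pairwise pairwise_map.
  apply: sub_pairwise => a b /= ab; rewrite incomparableE //= !andbT (eq_sym b).
  by rewrite ab.
- by rewrite all_map; apply/allP => a; rewrite mem_kids => /IH.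
Qed.

Lemma chain_le p q D : p ++ q \in K \/ q = [::] -> mark_le D (mk (p ++ q)) ->
  tree_le (chain q D) (ctree K mk p).
Proof.
elim: q p => [|a q IH] p; first by rewrite cats0 ctreeE /= andbT.
case=> // pqK; rewrite -cat_rcons in pqK * => le_D.
apply/tree_leP; split; first exact: mark0_le.
move=> _ _ [[<- <-]|[]]; exists (ctree K mk (rcons p a)); last first.
  by apply: IH => //; left.
rewrite (ctreeE _ _ p) /=; apply/In_map; exists a => //; apply/In_mem; rewrite mem_kids.
have: rcons p a \in [::] :: K.
  by apply: (@node_catl _ K_closed _ q); rewrite inE pqK orbT.
by rewrite inE; case: eqP => // e; case: (p) e.
Qed.

Lemma contains_path_ctree p D : p \in [::] :: K -> typed D -> mark_le D (mk p) ->
  contains_path (ctree K mk [::]) p D.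
Proof.
rewrite inE => pK typed_D le_D; exists (chain p D); first exact: is_path_chain.
by apply: chain_le => //; case/orP: pK => [/eqP|]; [right | left].
Qed.

(** The embedding goes down from the root: an extension by one component is again a node of [R], and
    by [subtrees_child] it hangs directly below its parent. *)
Lemma ctree_le R : pid_tree R ->
  (forall p, p \in K -> exists w, List.In (p, w) (subtrees R)) ->
  (forall p w, List.In (p, w) (subtrees R) -> mark_le (mk p) (root w)) ->
  tree_le (ctree K mk [::]) R.
Proof.
move=> tree_R R_K R_mk.
suff le p w : List.In (p, w) (subtrees R) -> tree_le (ctree K mk p) w.
  exact/le/subtrees_root.
elim/(kids_ind (K := K)): p w => p IH w pw; rewrite ctreeE.
apply/tree_leP; split=> [|_ _ /In_map[a /In_mem + [-> ->]]]; first exact: R_mk.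
rewrite mem_kids => paK; have [v pav] := R_K _ paK.
exists v; last exact: IH.
exact: subtrees_child tree_R pw pav.
Qed.

End Tree.

(** * Uniqueness of the representation of a clean marking *)

Definition canonical_tree M : tree (marking N) :=
  ctree (known_seq M) (node_mark M) [::].

Lemma rules_canonical M : net_invariant M -> clean M ->
  rules_satisfied M (canonical_tree M).
Proof.
move=> inv_M clean_M s v v_s; have typed_M := inv_typed inv_M.
have path p D : p \in [::] :: known_seq M -> typed D ->
    mark_le D (node_mark M p) -> contains_path (canonical_tree M) p D.
  by apply: contains_path_ctree => q a; apply: known_closed.
have path0 p : known_pids M p -> contains_path (canonical_tree M) p mark0.
  move=> /known_seqP pK; apply: path; last exact: mark0_le.
    by rewrite inE pK orbT.
  exact: typed_mark0.
have pathv p : pidv O p \in v -> contains_path (canonical_tree M) p mark0.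
  by move=> pv; apply: path0; left; exists s, v.
have [e|ns] := eqVneq s gen.
  have /gen_typeP[p [k ev]] : has_type [:: SPid; SNat] v.
    by rewrite -(tnet_gen_type N) -e (typedP typed_M).
  rewrite {}e {}ev in v_s *; apply: (@generator_rule _ _ _ _ _ _ _ p k) => //.
    by apply: path0; left; apply: eta_active v_s.
  by apply: path0; right; exists p, k.
(* Outside the generator place a type is nonempty and has no [SNat], so its first sort decides
   between the owned and the shared rule. *)
have [ty0 tyN] := tnet_place_type ns; have := typedP typed_M v_s.
case ty: (place_type s) ty0 tyN => [|[||] ty'] // _ _ v_ty.
- case: v v_ty v_s pathv => [|[x|d] v'] //= _ v_s pathv.
  apply: (@owned_rule _ _ _ _ _ _ _ ty' x v') => //; apply: path.
  + rewrite inE; apply/orP; right; apply/known_seqP; left.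
    by exists s, (pidv O x :: v'); rewrite mem_head.
  + exact: typed_mark_tok.
  + by apply: mark_le_tok; rewrite node_markE // /owner ty eqxx.
- apply: (@shared_rule _ _ _ _ _ _ _ ty') => //; apply: path => //.
    exact: typed_mark_tok.
  by apply: mark_le_tok; rewrite node_markE // /owner ty eqxx.
Qed.

(** Each known pid ends a path that some rule requires, and each token outside the generator place
    decorates the node of its owner. As a pid has only one node in [R], all these decorations
    accumulate there. *)
Lemma canonical_tree_le M R : pid_tree R -> rules_satisfied M R ->
  tree_le (canonical_tree M) R.
Proof.
move=> tree_R rules_R; apply: ctree_le => // [p|p w pw].
  case/known_seqP=> [[s [tok [tok_s p_tok]]]|[q [k [qk ->]]]].
    have [q i _ etok path _|ty _ _ _ path|ty x v' _ _ _ _ path] := rules_R _ _ tok_s.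
    - move: p_tok; rewrite etok.
    rewrite pid_in_gen_token => /eqP ->.
      by have [w] := contains_path_subtree path; exists w.
    - by have [w] := contains_path_subtree (path _ p_tok); exists w.
    - by have [w] := contains_path_subtree (path _ p_tok); exists w.
  have [q' i _ [-> ->] _ path|ty|ty x v'] := rules_R _ _ qk.
  - by have [w] := contains_path_subtree path; exists w.
  - by rewrite eqxx.
  - by rewrite eqxx.
apply/forallP=> s; apply/msubsetP => tok; have [->|ns] := eqVneq s gen.
  by rewrite ffunE eqxx mset0E.
rewrite node_markE //; case: eqP => // e; rewrite -{}e /owner in pw.
have [->//|] := posnP (M s tok).
rewrite -in_mset => tok_s.
have [q i e|ty _ ety path _|ty x v' _ ety ev path _] := rules_R _ _ tok_s.
- by rewrite e eqxx in ns.
- have [w' pw' /mark_tok_le le_w'] := contains_path_subtree path.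
  by rewrite ety in pw; rewrite (subtrees_inj tree_R pw pw').
- have [w' pw' /mark_tok_le le_w'] := contains_path_subtree path.
  by rewrite ety ev in pw; rewrite ev (subtrees_inj tree_R pw pw') -ev.
Qed.

(** The canonical tree satisfies the rules and is included in [R], so the minimality of [R] forces
    equality. *)
Lemma representation_canonical M R : net_invariant M -> clean M ->
  representation M R -> R = canonical_tree M.
Proof.
move=> inv_M clean_M [tree_R _ rules_R min_R]; apply/esym/min_R.
- by apply: pid_tree_ctree => p; apply/typed_node_mark/(inv_typed inv_M).
- exact: sibling_ordered_ctree.
- exact: rules_canonical.
- exact: canonical_tree_le.
Qed.

End Representation.

(** * Isomorphisms of prefix-closed sets of pids *)

Lemma pid_parent1P p q : reflect (exists a, q = rcons p a) (pid_parent1 p q).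
Proof.
apply: (iffP andP) => [[q0 /eqP ->]|[a ->]].
  by case/lastP: q q0 => // q a _; exists a; rewrite pid_prefix_rcons.
by rewrite size_rcons pid_prefix_rcons.
Qed.

Lemma prefix_rconsr (T : eqType) (p q : seq T) a :
  prefix p (rcons q a) = (p == rcons q a) || prefix p q.
Proof.
apply/idP/orP=> [|[/eqP ->|pq]]; last 2 first.
- exact: prefix_refl.
- exact: prefix_trans pq (prefix_rcons _ _).
case/prefixP=> s; case/lastP: s => [|s b]; rewrite ?cats0 -?rcons_cat.
  by move=> ->; left.
by case/rcons_inj=> -> _; right; apply: prefix_prefix.
Qed.

(** In a strictly increasing sequence nothing fits between a value and its successor, so consecutive
    values occupy consecutive positions. A condition on neighbouring siblings thereby controls all
    pairs of siblings. *)
Lemma nth_succ_sorted (s : seq nat) i j :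
  sorted ltn s -> i < size s -> j < size s ->
  (nth 0 s j == (nth 0 s i).+1) =
  (j == i.+1) && (nth 0 s i.+1 - nth 0 s i == 1).
Proof.
move=> s_sorted i_lt j_lt; have mono := sorted_ltn_nth ltn_trans 0 s_sorted.
have [->|ij] := eqVneq j i.+1; last first.
  apply/negP=> /eqP e; have [lt_ij|le_ji] := ltnP i j.
    have lt_ij' : i.+1 < j by rewrite ltn_neqAle eq_sym ij.
    have i1_lt := ltn_trans lt_ij' j_lt.
    have := mono i i.+1 i_lt i1_lt (ltnSn _); have := mono i.+1 j i1_lt j_lt lt_ij'.
    by rewrite e ltnS => /leq_ltn_trans H /H; rewrite ltnn.
  move: le_ji e; rewrite leq_eqVlt => /orP[/eqP -> /eqP|/(mono _ _ j_lt i_lt)].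
    by rewrite (ltn_eqF (ltnSn _)).
  by move=> lt e; move: lt; rewrite e ltnNge leqnSn.
have [i1_lt|i1_ge] := ltnP i.+1 (size s).
  by have := mono i i.+1 i_lt i1_lt (ltnSn _) => /=; lia.
by rewrite (nth_default 0 i1_ge) /= sub0n.
Qed.

Lemma index_map_in (S T : eqType) (f : S -> T) (s : seq S) x :
  {in s &, injective f} -> x \in s -> index (f x) (map f s) = index x s.
Proof.
elim: s => //= y s IH f_inj xs; rewrite (inj_in_eq f_inj) ?mem_head //.
case: eqVneq => // yx; rewrite IH //; last by move: xs; rewrite inE eq_sym (negPf yx).
by move=> u v us vs; apply: f_inj; rewrite inE ?us ?vs orbT.
Qed.

Section Isomorphism.

Variables (K1 K2 : seq pid) (f : pid -> pid).
Hypothesis K1_closed : forall p a, rcons p a \in K1 -> p \in [::] :: K1.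
Hypothesis f_nil : f [::] = [::].
Hypothesis f_inj : {in [::] :: K1 &, injective f}.
Hypothesis f_surj : forall q, q \in K2 -> exists2 p, p \in K1 & f p = q.
Hypothesis f_mem : forall p, p \in K1 -> f p \in K2.
Hypothesis f_rcons : forall p a, rcons p a \in K1 ->
  exists a', f (rcons p a) = rcons (f p) a'.

(** The component by which the image of [rcons p a] extends [f p]; the argument [a] serves as the
    default of [last]. *)
Definition child_map p (a : posnat) : posnat := last a (f (rcons p a)).

Lemma f_child p a : rcons p a \in K1 -> f (rcons p a) = rcons (f p) (child_map p a).
Proof. by move=> /f_rcons[a' e]; rewrite /child_map e last_rcons. Qed.

Lemma node_cons p : p \in K1 -> p \in [::] :: K1.
Proof. by rewrite inE orbC => ->. Qed.

Lemma iso_parent1 p q : p \in K1 -> q \in K1 -> [::] \notin K1 ->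
  pid_parent1 p q = pid_parent1 (f p) (f q).
Proof.
move=> pK qK K1_nil; apply/pid_parent1P/pid_parent1P => [[a eq]|[a']].
  by rewrite eq in qK *; exists (child_map p a); apply: f_child.
case/lastP: q qK => [|q a] qK; first by case/negP: K1_nil.
rewrite f_child // => /rcons_inj[e _]; exists a; congr rcons.
by apply: f_inj e; [apply: K1_closed qK | apply: node_cons].
Qed.

(** The prefixes of [rcons q a] are itself and the prefixes of [q], so injectivity and commutation
    with the parent suffice, by induction on [q]. *)
Lemma iso_prefix p q : p \in [::] :: K1 -> q \in [::] :: K1 ->
  prefix (f p) (f q) = prefix p q.
Proof.
move=> pK; elim/last_ind: q => [|q a IH] qK.
  by rewrite f_nil !prefixs0 -{1}f_nil (inj_in_eq f_inj).
have qaK : rcons q a \in K1 by move: qK; rewrite inE; case: (q).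
rewrite {1}f_child // !prefix_rconsr -f_child // (inj_in_eq f_inj) // IH //.
exact: K1_closed qaK.
Qed.

Section Order.

Hypothesis child_mono : forall p a b, rcons p a \in K1 -> rcons p b \in K1 ->
  val a < val b -> val (child_map p a) < val (child_map p b).

(** Both lists are strictly increasing, and such a list is determined by its members. *)
Lemma kids_iso p : p \in [::] :: K1 -> kids K2 (f p) = map (child_map p) (kids K1 p).
Proof.
move=> pK; apply: (irr_sorted_eq (leT := relpre val ltn)).
- by move=> x y z; apply: ltn_trans.
- by move=> x; apply: ltnn.
- by rewrite -sorted_map kids_sorted.
- have := kids_sorted K1 p; rewrite !sorted_map.
  apply: (sub_in_sorted (P := [in kids K1 p])); last by apply/allP.
  by move=> a b /=; rewrite !mem_kids; apply: child_mono.
- move=> b; rewrite mem_kids; apply/idP/mapP=> [/f_surj[q]|[a]].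
    case/lastP: q => [_|q a qK]; first by rewrite f_nil; case: (f p).
    rewrite f_child // => /rcons_inj[/f_inj e <-].
    have {}e : q = p by apply: e => //; apply: K1_closed qK.
    by rewrite {}e in qK *; exists a; rewrite // mem_kids.
  by rewrite mem_kids => paK ->; rewrite -f_child // f_mem.
Qed.

Lemma ranks_iso p : p \in [::] :: K1 -> ranks K2 [::] (f p) = ranks K1 [::] p.
Proof.
elim/last_ind: p => [|p a IH] pK; first by rewrite f_nil.
have paK : rcons p a \in K1 by move: pK; rewrite inE; case: (p).
have {}pK := K1_closed paK.
rewrite f_child // !ranks_rcons IH // /= kids_iso //.
have map_inj : {in kids K1 p &, injective (child_map p)}.
  move=> x y; rewrite !mem_kids => xK yK e.
  have : rcons p x = rcons p y by apply: f_inj; rewrite ?node_cons // !f_child ?e.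
  by case/rcons_inj.
by rewrite index_map_in // mem_kids.
Qed.

End Order.

End Isomorphism.

(** * State equivalence and pid-tree equivalence *)

Lemma mset_mapE (K L : choiceType) (f : K -> L) (A : {mset K}%mset) x :
  mset_map f A x = count (fun t => f t == x) A.
Proof. by rewrite mset_seqE count_map. Qed.

Lemma mem_map_pid (O : choiceType) (f : pid -> pid) q (tok : token O) :
  pidv O q \in map_pid f tok <-> exists2 p, pidv O p \in tok & q = f p.
Proof.
split=> [/mapP[[p|d] // p_tok [->]]|[p p_tok ->]]; first by exists p.
by apply/mapP; exists (pidv O p).
Qed.

(** * Reading a clean marking off its canonical tree *)

Section Marking.

Variables (O : choiceType) (V : eqType) (N : tnet O V) (M : marking N).
Hypotheses (inv_M : net_invariant M) (clean_M : clean M).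

Local Notation gen := (gen_place N).

(** The counter bounds the indices of active children by [k], whereas the next pid has index
    [k + 1]. *)
Lemma next_not_active p k : eta M p k -> ~ active_pids M (pid_next p k).
Proof.
by move=> pk /(inv_fresh inv_M pk)/(_ (prefix_refl _)); rewrite ltnn.
Qed.

Lemma in_subtrees_canonical p u : List.In (p, u) (subtrees (canonical_tree M)) <->
  u = ctree (known_seq M) (node_mark M) p /\ p \in [::] :: known_seq M.
Proof.
rewrite in_subtrees_ctree => [|q a]; last exact: known_closed.
rewrite inE; split=> -[-> pK]; split=> //; first by case: pK => [->|->]; rewrite ?orbT.
by case/orP: pK => [/eqP|]; [left | right].
Qed.

Lemma canonical_pids p :
  (p \in tree_pids (canonical_tree M)) = (p \in [::] :: known_seq M).
Proof. by apply: tree_pids_ctree => q a; apply: known_closed. Qed.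

Lemma relpath_canonical p : p \in [::] :: known_seq M ->
  relpath p (canonical_tree M) = ranks (known_seq M) [::] p.
Proof.
rewrite inE => pK; apply: relpath_ctree; first by move=> q a; apply: known_closed.
by case/orP: pK => [/eqP|]; [right | left].
Qed.

(* An active leaf is not a generator, since its next pid would be a child of it;
   being active, it then occurs in some token of another place. *)
Lemma next_pids_leaf q : q \in known_seq M ->
  next_pids M q <-> kids (known_seq M) q = [::] /\
    forall s tok, s != gen -> tok \in M s -> pidv O q \notin tok.
Proof.
move=> qK; split=> [[p [k [pk eq]]]|[leaf no_tok]].
  have q_dead : ~ active_pids M q by rewrite eq; apply: next_not_active.
  split=> [|s tok _ tok_s]; last by apply/negP=> q_tok; apply: q_dead; exists s, tok.
  case e: kids => [|a l] //; case: q_dead.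
  have: a \in kids (known_seq M) q by rewrite e mem_head.
  rewrite mem_kids => /known_seqP qa; apply: known_parent qa _ => //.
  by rewrite eq; case: (p).
move/known_seqP: qK => -[[s [tok [tok_s q_tok]]]|] //.
have [e|ns] := eqVneq s gen; last by case/negP: (no_tok _ _ ns tok_s).
have /gen_typeP[p [k etok]] : has_type [:: SPid; SNat] tok.
  by rewrite -(tnet_gen_type N) -e (typedP (inv_typed inv_M)).
move: q_tok tok_s; rewrite etok e pid_in_gen_token => /eqP <- qk.
have: posS k \in kids (known_seq M) q.
  by rewrite mem_kids; apply/known_seqP; right; exists q, k.
by rewrite leaf.
Qed.

Lemma owner_known s tok : tok \in M s -> owner s tok \in [::] :: known_seq M.
Proof.
move=> tok_s; rewrite /owner inE; case: place_type => [|[||] ty] //.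
case: tok tok_s => [|[p|d] tok] // tok_s; apply/orP; right; apply/known_seqP; left.
by exists s, (pidv O p :: tok); rewrite mem_head.
Qed.

Lemma known_one a : known_pids M [:: a] -> a = posS 0.
Proof. by move=> /(known_root inv_M) /=; rewrite andbT => /eqP. Qed.

Lemma node_mark_mapE f p s v : s != gen ->
  mset_map (map_pid f) (node_mark M p s) v =
  count (fun tok => (map_pid f tok == v) && (owner s tok == p)) (M s).
Proof.
move=> /negPf ns; rewrite mset_mapE ffunE ns.
by rewrite (permP (perm_eq_seq_mset _)) count_filter.
Qed.

End Marking.

Lemma owner_map (O : choiceType) (V : eqType) (N : tnet O V) f (s : place N)
    (tok : token O) :
  f [::] = [::] -> owner s (map_pid f tok) = f (owner s tok).
Proof.
by move=> f0; rewrite /owner; case: place_type => [|[||] ty] //; case: tok => [|[]].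
Qed.

(** The decorations split the tokens of a place by owner, and renaming commutes with taking the
    owner. Renaming the marking is therefore the same as renaming it node by node. *)
Lemma node_marks_iso (O : choiceType) (V : eqType) (N : tnet O V)
    (M1 M2 : marking N) (f : pid -> pid) (s : place N) :
  s != gen_place N -> f [::] = [::] ->
  {in [::] :: known_seq M1 &, injective f} ->
  (forall q, q \in [::] :: known_seq M2 ->
     exists2 p, p \in [::] :: known_seq M1 & f p = q) ->
  M2 s = mset_map (map_pid f) (M1 s) <->
  forall p, p \in [::] :: known_seq M1 ->
    node_mark M2 (f p) s = mset_map (map_pid f) (node_mark M1 p s).
Proof.
move=> ns f0 f_inj f_surj.
(* If [f p] owns [v], injectivity shows that all tokens renamed to [v] are owned by [p]; otherwise
   no token of [p] is renamed to [v]. *)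
have countE p v : p \in [::] :: known_seq M1 ->
    mset_map (map_pid f) (node_mark M1 p s) v =
    if owner s v == f p then mset_map (map_pid f) (M1 s) v else 0.
  move=> pK; rewrite node_mark_mapE // mset_mapE; case: eqP => e.
    apply: eq_in_count => tok tok_s /=; case: eqP => //= etok.
    rewrite -(inj_in_eq f_inj) ?(owner_known tok_s) // -owner_map // etok.
    exact/eqP.
  apply/eqP; rewrite -leqn0 leqNgt -has_count; apply/hasPn => tok _.
  by apply/negP=> /andP[/eqP etok /eqP eo]; apply: e; rewrite -etok owner_map ?eo.
split=> [eM p pK|eM]; apply/msetP => v; first by rewrite countE // node_markE // eM.
have [/hasP[p pK /eqP ev]|no_p] :=
  boolP (has (fun p => f p == owner s v) ([::] :: known_seq M1)).
  by have := countE p v pK; rewrite -eM // node_markE // ev eqxx.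
(* If the owner of [v] is not the image of a node, [v] occurs on neither side. *)
have -> : M2 s v = 0.
  apply/mset_eq0P/negP => /owner_known/f_surj[p pK ev].
  by case/hasP: no_p; exists p; rewrite ?ev.
apply/esym/eqP; rewrite mset_mapE -leqn0 leqNgt -has_count; apply/hasPn => tok tok_s.
apply/negP=> /eqP etok; case/hasP: no_p; exists (owner s tok).
  exact: owner_known.
by rewrite -etok owner_map.
Qed.

Section Equivalence.

Variables (O : choiceType) (V : eqType) (N : tnet O V) (M1 M2 : marking N).
Hypotheses (inv1 : net_invariant M1) (inv2 : net_invariant M2).
Hypotheses (clean1 : clean M1) (clean2 : clean M2).

Local Notation gen := (gen_place N).
Local Notation K1 := (known_seq M1).
Local Notation K2 := (known_seq M2).

Let K1_nil : [::] \notin K1. Proof. exact: known_nonnil. Qed.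
Let K2_nil : [::] \notin K2. Proof. exact: known_nonnil. Qed.
Let K1_closed p a : rcons p a \in K1 -> p \in [::] :: K1.
Proof. exact: known_closed. Qed.
Let K2_closed p a : rcons p a \in K2 -> p \in [::] :: K2.
Proof. exact: known_closed. Qed.

(** * From pid-tree equivalence to state equivalence *)

Section TreeToState.

Variable f : pid -> pid.
Hypothesis f_equiv : tree_equiv_by f (canonical_tree M1) (canonical_tree M2).

Let f_node p : p \in [::] :: K1 -> f p \in [::] :: K2.
Proof.
have [_ [f_fun _ _] _] := f_equiv; rewrite -!canonical_pids //.
exact: f_fun.
Qed.

Let f_inj : {in [::] :: K1 &, injective f}.
Proof.
have [_ [_ inj _] _] := f_equiv => p q; rewrite -!canonical_pids // => pT qT.
by apply: inj; apply/mem_set.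
Qed.

Let f_surj q : q \in [::] :: K2 -> exists2 p, p \in [::] :: K1 & f p = q.
Proof.
have [_ [_ _ surj] _] := f_equiv; rewrite -canonical_pids // => /surj[p pT <-].
by exists p => //; rewrite -canonical_pids.
Qed.

Let f_ranks p : p \in [::] :: K1 -> ranks K2 [::] (f p) = ranks K1 [::] p.
Proof.
move=> pK; have [relE _ _] := f_equiv; rewrite -!relpath_canonical ?f_node //.
by apply/esym/relE; rewrite ?canonical_pids ?f_node.
Qed.

Let f_nil : f [::] = [::].
Proof.
apply: (ranks_inj K2_nil K2_closed); rewrite ?f_node ?mem_head //.
by rewrite f_ranks ?mem_head.
Qed.

Let f_mem p : p \in K1 -> f p \in K2.
Proof.
move=> pK; have := f_node (node_cons pK); rewrite inE => /orP[|//].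
rewrite -{1}f_nil (inj_in_eq f_inj) ?mem_head ?(node_cons pK) // => /eqP e.
by case/negP: (K1_nil); rewrite -e.
Qed.

Let f_surjK q : q \in K2 -> exists2 p, p \in K1 & f p = q.
Proof.
move=> qK; have [p + e] := f_surj (node_cons qK); rewrite inE => /orP[/eqP p0|pK].
  by case/negP: (K2_nil); rewrite -f_nil -p0 e.
by exists p.
Qed.

(** Dropping the last rank of the image leaves the ranks of [f p], so [ranks_inj] identifies the
    parent of the image with [f p]. *)
Let f_rcons_index p a : rcons p a \in K1 -> exists2 a',
  f (rcons p a) = rcons (f p) a' &
  index a' (kids K2 (f p)) = index a (kids K1 p).
Proof.
move=> paK; have pK := K1_closed paK; have := f_ranks (node_cons paK).
have := f_mem paK; case/lastP: (f _) => [|q b] qK; first by case/negP: (K2_nil).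
rewrite !ranks_rcons => /rcons_inj[e [eb]].
have <- : q = f p.
  by apply: (ranks_inj K2_nil K2_closed); rewrite ?f_node ?f_ranks // (K2_closed qK).
by exists b.
Qed.

Let f_rcons p a : rcons p a \in K1 -> exists a', f (rcons p a) = rcons (f p) a'.
Proof. by case/f_rcons_index=> a'; exists a'. Qed.

Let fE := f_child f_rcons.

Let child_index p a : rcons p a \in K1 ->
  index (child_map f p a) (kids K2 (f p)) = index a (kids K1 p).
Proof. by move=> /[dup] /fE e /f_rcons_index[a']; rewrite e => /rcons_inj[->]. Qed.

Let child_kid p a : rcons p a \in K1 -> child_map f p a \in kids K2 (f p).
Proof. by move=> paK; rewrite mem_kids -fE // f_mem. Qed.

Let f_node_equiv p : p \in [::] :: K1 ->
  node_equiv f (canonical_tree M1) (ctree K1 (node_mark M1) p)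
    (ctree K2 (node_mark M2) (f p)).
Proof.
move=> pK; have [_ _] := f_equiv; apply; apply/in_subtrees_canonical => //.
by split=> //; apply: f_node.
Qed.

Let f_marks s : s != gen -> M2 s = mset_map (map_pid f) (M1 s).
Proof.
move=> ns; apply/node_marks_iso => // p /f_node_equiv[_ /(_ _ ns)[_]].
by rewrite !root_ctree.
Qed.

Let size_kids p : p \in [::] :: K1 -> size (kids K2 (f p)) = size (kids K1 p).
Proof. by move=> /f_node_equiv[+ _ _ _]; rewrite !size_children_ctree. Qed.

(** By [next_pids_leaf], next pids are the leaves that occur in no token outside the generator
    place, and [f] preserves both properties. *)
Let f_next q : q \in K1 -> next_pids M1 q <-> next_pids M2 (f q).
Proof.
move=> qK; rewrite !next_pids_leaf ?f_mem //.
have leafE : kids K2 (f q) = [::] <-> kids K1 q = [::].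
  have := size_kids (node_cons qK).
  by case: (kids K2 _) => [|? ?]; case: (kids K1 _).
split=> -[/leafE leaf no_tok]; split=> // s tok ns.
  rewrite f_marks // mem_seq_mset => /mapP[tok' tok'_s ->]; apply/negP.
  case/mem_map_pid=> p p_tok' /f_inj e; have pK : p \in K1.
    by apply/known_seqP; left; exists s, tok'.
  by have /negP[] := no_tok _ _ ns tok'_s; rewrite e ?node_cons.
move=> tok_s; have := no_tok s (map_pid f tok) ns.
rewrite f_marks // mem_seq_mset map_f // => /(_ isT); apply: contra => q_tok.
by apply/mem_map_pid; exists q.
Qed.

Let eta_dom_known p : eta_dom M1 p -> p \in K1.
Proof. by case=> k /eta_active pk; apply/known_seqP; left. Qed.

(** A process is a generator exactly when it is the parent of a next pid, and [f] respects next pids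
    and parents. *)
Let f_eta p : p \in K1 -> eta_dom M1 p <-> eta_dom M2 (f p).
Proof.
move=> pK; split=> -[k pk].
  have nextK : pid_next p k \in K1 by apply/known_seqP; right; exists p, k.
  have /f_next : next_pids M1 (pid_next p k) by exists p, k.
  case/(_ nextK)=> q [k' [qk']]; rewrite fE // => /rcons_inj[-> _].
  by exists k'.
have : next_pids M2 (pid_next (f p) k) by exists (f p), k.
have /f_surjK[r rK er] : pid_next (f p) k \in K2.
  by apply/known_seqP; right; exists (f p), k.
rewrite -er -f_next // => -[q [k' [qk' e]]]; rewrite {}e in rK er.
move: er; rewrite fE // => /rcons_inj[/f_inj e _].
by exists k'; rewrite -e // node_cons // (eta_dom_known (_ : eta_dom M1 q)) //; exists k'.
Qed.

Let f_eta_next p k k' : eta M1 p k -> eta M2 (f p) k' ->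
  f (pid_next p k) = pid_next (f p) k'.
Proof.
move=> pk pk'; have nextK : pid_next p k \in K1.
  by apply/known_seqP; right; exists p, k.
have /f_next : next_pids M1 (pid_next p k) by exists p, k.
case/(_ nextK)=> q [k2 [qk2 e]]; rewrite e.
move: e; rewrite fE // => /rcons_inj[e _]; rewrite -e in qk2 *.
(* The image is a next pid of [f p] for some counter; the uniqueness of counters makes this counter
   [k']. *)
by rewrite (inv_eta_inj inv2 qk2 pk').
Qed.

Let lt_child p a b : rcons p a \in K1 -> rcons p b \in K1 ->
  (val (child_map f p a) < val (child_map f p b)) = (val a < val b).
Proof.
move=> paK pbK; rewrite -(ltn_index_kids (child_kid paK) (child_kid pbK)).
by rewrite !child_index // ltn_index_kids // mem_kids.
Qed.

(** The equivalence compares gaps between neighbouring kids only. By [nth_succ_sorted] this is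
    enough, as ranks are preserved and only neighbours can be consecutive. *)
Let succ_child p a b : rcons p a \in K1 -> rcons p b \in K1 ->
  (val (child_map f p b) == (val (child_map f p a)).+1) = (val b == (val a).+1).
Proof.
move=> paK pbK; have pK := K1_closed paK.
have kE K q c : c \in kids K q -> val c = nth 0 (map val (kids K q)) (index c (kids K q)).
  by move=> cq; rewrite (nth_map c) ?index_mem // nth_index.
have kid c : rcons p c \in K1 -> c \in kids K1 p by rewrite mem_kids.
rewrite (kE _ _ _ (kid _ paK)) (kE _ _ _ (kid _ pbK)).
rewrite (kE _ _ _ (child_kid paK)) (kE _ _ _ (child_kid pbK)) !child_index //.
have a_lt : index a (kids K1 p) < size (kids K1 p) by rewrite index_mem kid.
have b_lt : index b (kids K1 p) < size (kids K1 p) by rewrite index_mem kid.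
rewrite !nth_succ_sorted ?size_map ?size_kids ?kids_sorted //.
case: eqP => //= e; rewrite {}e in b_lt.
have [_ _ _] := f_node_equiv pK; move/(_ (index a (kids K1 p))).
rewrite size_children_ctree !child_labels_ctree => /(_ b_lt).
have nthE K q i : i < size (kids K q) ->
    nth [::] [seq [:: c] | c <- kids K q] i = [:: nth a (kids K q) i].
  by move=> i_lt; rewrite (nth_map a).
have nthE' K q i : i < size (kids K q) ->
    nth 0 (map val (kids K q)) i = val (nth a (kids K q) i).
  by move=> i_lt; rewrite (nth_map a).
rewrite !nthE ?size_kids // !nthE' ?size_kids // => /(_ erefl)[_].
rewrite /pid_last /=; case=> [[-> ->]|[/gtn_eqF -> /gtn_eqF ->]] //.
Qed.

Let f_siblings (r r' : rel nat) p q : p \in K1 -> q \in K1 ->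
  (forall u a b, rcons u a \in K1 -> rcons u b \in K1 ->
     r' (val (child_map f u a)) (val (child_map f u b)) = r (val a) (val b)) ->
  pid_siblings r p q = pid_siblings r' (f p) (f q).
Proof.
case/lastP: p => [|u a] paK; first by case/negP: (K1_nil).
case/lastP: q => [|w b] qbK; first by case/negP: (K1_nil).
move=> rE; rewrite /pid_siblings !fE // !pid_prefix_rcons !pid_last_rcons.
have uK := K1_closed paK; have wK := K1_closed qbK.
rewrite (inj_in_eq f_inj) // -{2}f_nil (inj_in_eq f_inj) ?mem_head //.
by case: eqP => //= e; rewrite -{}e in qbK *; rewrite rE.
Qed.

Lemma tree_to_state : state_equiv_by f M1 M2.
Proof.
split; first split.
- by move=> p /known_seqP/f_mem/known_seqP.
- move=> p q /set_mem/known_seqP pK /set_mem/known_seqP qK.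
  by apply: f_inj; apply: node_cons.
- by move=> q /known_seqP/f_surjK[p /known_seqP pK <-]; exists p.
split.
- apply/seteqP; split=> [_ [p p_dom <-]|q q_dom].
    exact: (proj1 (f_eta (eta_dom_known p_dom)) p_dom).
  have /f_surjK[p pK e] : q \in K2.
    by case: q_dom => k /eta_active qk; apply/known_seqP; left.
  by exists p; rewrite -?e // in q_dom *; apply/f_eta.
- exact: f_eta_next.
- move=> p q /active_seqP pA /active_seqP qA.
  have pK : p \in K1 by rewrite mem_cat pA.
  have qK : q \in K1 by rewrite mem_cat qA.
  split; first exact: (iso_parent1 K1_closed f_inj f_rcons).
  rewrite /pid_parent (iso_prefix K1_closed f_nil f_inj f_rcons) ?node_cons //.
  by rewrite (inj_in_eq f_inj) ?node_cons.
- move=> p q /known_seqP pK /known_seqP qK.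
  by split; apply: f_siblings.
- exact: f_marks.
Qed.

End TreeToState.

(** * From state equivalence to pid-tree equivalence *)

Section StateToTree.

Variable h : pid -> pid.
Hypothesis h_equiv : state_equiv_by h M1 M2.

(* [h] is unconstrained on the empty pid, which labels the root. *)
Let f (p : pid) : pid := if p == [::] then [::] else h p.

Let f_nil : f [::] = [::]. Proof. by []. Qed.

Let fE p : p \in K1 -> f p = h p.
Proof. by rewrite /f; case: eqP => // -> pK; case/negP: (K1_nil). Qed.

Let f_mem p : p \in K1 -> f p \in K2.
Proof.
move=> pK; rewrite fE //; have [[h_fun _ _] _] := h_equiv.
by apply/known_seqP/h_fun/known_seqP.
Qed.

Let f_injK : {in K1 &, injective f}.
Proof.
have [[_ inj _] _] := h_equiv => p q pK qK; rewrite !fE //.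
by apply: inj; apply/mem_set/known_seqP.
Qed.

Let f_inj : {in [::] :: K1 &, injective f}.
Proof.
have f_neq p : p \in K1 -> f p <> [::].
  by move/f_mem=> + e; rewrite e => pK; case/negP: (K2_nil).
move=> p q; rewrite !inE => /orP[/eqP ->|pK] /orP[/eqP ->|qK] //.
- by rewrite f_nil => /esym /f_neq.
- by rewrite f_nil => /f_neq.
- exact: f_injK.
Qed.

Let f_surjK q : q \in K2 -> exists2 p, p \in K1 & f p = q.
Proof.
have [[_ _ surj] _] := h_equiv => /known_seqP/surj[p /known_seqP pK <-].
by exists p; rewrite ?fE.
Qed.

Let activeK p : active_pids M1 p -> p \in K1.
Proof. by move=> p_act; apply/known_seqP; left. Qed.

Let nextK p k : eta M1 p k -> pid_next p k \in K1.
Proof. by move=> pk; apply/known_seqP; right; exists p, k. Qed.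

Let f_eta p k : eta M1 p k -> exists2 k', eta M2 (f p) k' &
  f (pid_next p k) = pid_next (f p) k'.
Proof.
move=> pk; have [_ [h_dom h_next _ _ _]] := h_equiv.
rewrite !fE ?nextK ?activeK //; last exact: eta_active pk.
have [k' pk'] : eta_dom M2 (h p) by rewrite -h_dom; exists p => //; exists k.
by exists k' => //; apply: h_next.
Qed.

(** If the image were only the next pid of some [h r], it would be the image of the next pid of [r].
    By injectivity [p] would be that next pid, which is not active. *)
Let f_active p : active_pids M1 p -> active_pids M2 (f p).
Proof.
move=> p_act; have /known_seqP[//|[q [k [qk e]]]] := f_mem (activeK p_act).
have [_ [h_dom _ _ _ _]] := h_equiv.
have [r [k' rk'] er] : (h @` eta_dom M1)%classic q by rewrite h_dom; exists k.
have rK : r \in K1 by apply/activeK/(eta_active rk').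
have [k2 rk2] := f_eta rk'; rewrite fE // er in rk2 *.
rewrite -(inv_eta_inj inv2 qk rk2) -e => /f_injK er'.
by case: (next_not_active inv1 rk'); rewrite er' ?nextK ?activeK.
Qed.

Let f_parent1 p q : active_pids M1 p -> active_pids M1 q ->
  pid_parent1 p q = pid_parent1 (f p) (f q).
Proof.
move=> p_act q_act; have [_ [_ _ h_par _ _]] := h_equiv.
by rewrite !fE ?activeK //; have [] := h_par _ _ p_act q_act.
Qed.

(** Were <1> sent elsewhere, cleanness would give its image an active parent. The preimage of this
    parent would be a parent of <1>, hence the empty pid, which is not known. *)
Let f_one a : [:: a] \in K1 -> f [:: a] = [:: posS 0].
Proof.
move=> /known_seqP aK; have ea := known_one inv1 aK; rewrite {}ea in aK *.
have one_act : active_pids M1 pid_one.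
  case: aK => // -[q [k [/eta_active/(inv_root inv1) + e]]].
  by case: q e => [|b [|c q]] //= [].
apply: contrapT => neq; have f_act := f_active one_act.
have par_act : active_pids M2 (pid_prefix (f pid_one)).
  by apply: clean2 => //; left.
have [[_ _ surj] _] := h_equiv.
have /f_surjK[r rK er] : pid_prefix (f pid_one) \in K2 by apply/known_seqP; left.
(* If [r] were a next pid, so would be its image, which is active. *)
have r_act : active_pids M1 r.
  case/known_seqP: (rK) => // -[q [k [qk e]]].
  have [k' qk' e'] := f_eta qk; case: (next_not_active inv2 qk').
  by rewrite -e' -e er.
have : pid_parent1 (f r) (f pid_one).
  rewrite er /pid_parent1 eqxx andbT lt0n size_eq0.
  by apply/eqP=> e; case/negP: (K2_nil); rewrite -e; apply/known_seqP; left.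
rewrite -f_parent1 // => /pid_parent1P[b]; case: r rK {er r_act} => [|c [|]] // r_nil.
by case/negP: (K1_nil).
Qed.

(** State equivalence compares parents of active pids only. For a next pid its compatibility with
    [next] takes over, and below the root the only case is <1>. *)
Let f_rcons p a : rcons p a \in K1 -> exists a', f (rcons p a) = rcons (f p) a'.
Proof.
have [->|/eqP p0] := eqVneq p [::]; first by move/f_one=> ->; exists (posS 0).
move=> /[dup] paK /known_seqP pa; have p_act := known_parent inv1 clean1 pa p0.
case: pa => [pa_act|[q [k [qk /rcons_inj[-> ->]]]]].
  by apply/pid_parent1P; rewrite -f_parent1 //; apply/pid_parent1P; exists a.
by have [k' _ ->] := f_eta qk; exists (posS k').
Qed.

Let fcE := f_child f_rcons.

Let f_siblings (r : rel nat) p a b : p <> [::] ->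
  pid_siblings r (rcons p a) (rcons p b) = r (val a) (val b).
Proof.
by move=> /eqP p0; rewrite /pid_siblings !pid_prefix_rcons !pid_last_rcons eqxx p0.
Qed.

Let f_node_nil p : p \in K1 -> f p <> [::].
Proof. by move/f_mem=> + e; rewrite e => pK; case/negP: (K2_nil). Qed.

Let child_rel p a b : rcons p a \in K1 -> rcons p b \in K1 ->
  (val a < val b) = (val (child_map f p a) < val (child_map f p b)) /\
  (val b == (val a).+1) = (val (child_map f p b) == (val (child_map f p a)).+1).
Proof.
(* The sibling relations exclude an empty common prefix, so they say nothing at the root; there <1>
   is the only possible child. *)
have [-> aK bK|/eqP p0 paK pbK] := eqVneq p [::].
  have -> : b = a.
    by move: aK bK => /known_seqP/(known_one inv1) -> /known_seqP/(known_one inv1) ->.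
  by rewrite !ltnn !(ltn_eqF (ltnSn _)).
have pK : p \in K1 by have := K1_closed paK; rewrite inE => /orP[/eqP|].
have [_ [_ _ _ h_sib _]] := h_equiv.
have [] := h_sib (rcons p a) (rcons p b); try exact/known_seqP.
have fp0 := f_node_nil pK.
rewrite -!fE // !fcE // /pid_sibling1 /pid_sibling !f_siblings //.
Qed.

Let child_mono p a b : rcons p a \in K1 -> rcons p b \in K1 ->
  val a < val b -> val (child_map f p a) < val (child_map f p b).
Proof. by move=> paK pbK; have [->] := child_rel paK pbK. Qed.

Let f_kids := kids_iso K1_closed f_nil f_inj f_surjK f_mem f_rcons child_mono.
Let f_ranks := ranks_iso K1_closed f_nil f_inj f_surjK f_mem f_rcons child_mono.

Let f_node p : p \in [::] :: K1 -> f p \in [::] :: K2.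
Proof. by rewrite inE => /orP[/eqP ->|/f_mem/node_cons]. Qed.

Let f_surj q : q \in [::] :: K2 -> exists2 p, p \in [::] :: K1 & f p = q.
Proof.
rewrite inE => /orP[/eqP ->|/f_surjK[p pK <-]]; last by exists p; rewrite ?node_cons.
by exists [::]; rewrite ?mem_head.
Qed.

Let map_pid_f s tok : tok \in M1 s -> map_pid f tok = map_pid h tok.
Proof.
move=> tok_s; apply/eq_in_map => -[p|d] // p_tok.
by rewrite fE //; apply: activeK; exists s, tok.
Qed.

Let f_marks s : s != gen -> M2 s = mset_map (map_pid f) (M1 s).
Proof.
have [_ [_ _ _ _ h_marks]] := h_equiv => /h_marks ->; congr seq_mset.
by apply/eq_in_map => tok tok_s; rewrite (map_pid_f tok_s).
Qed.

Let f_node_equiv p : p \in [::] :: K1 ->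
  node_equiv f (canonical_tree M1) (ctree K1 (node_mark M1) p)
    (ctree K2 (node_mark M2) (f p)).
Proof.
move=> pK; split.
- by rewrite !size_children_ctree f_kids // size_map.
- move=> s ns; rewrite !root_ctree; split.
    move=> tok q; rewrite mem_node_mark // => /andP[_ tok_s] q_tok.
    rewrite canonical_pids // node_cons // activeK //.
    by exists s, tok.
  by move: p pK; apply/node_marks_iso/f_marks.
- move=> i; rewrite size_children_ctree !child_labels_ctree f_kids // => i_lt.
  have a0 : posnat by case: (kids K1 p) i_lt.
  by left; rewrite !(nth_map a0) ?size_map.
- move=> i; rewrite size_children_ctree !child_labels_ctree f_kids // => i_lt.
  have a0 : posnat by case: (kids K1 p) i_lt.
  have i_lt' := ltnW i_lt; rewrite !(nth_map a0) ?size_map // => _; split=> //.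
  set a := nth a0 _ i; set b := nth a0 _ i.+1; rewrite /pid_last /=.
  have aK : rcons p a \in K1 by rewrite -mem_kids mem_nth.
  have bK : rcons p b \in K1 by rewrite -mem_kids mem_nth.
  have ab : val a < val b.
    by rewrite -(ltn_index_kids (K := K1) (p := p)) ?mem_kids // !index_uniq ?kids_uniq.
  (* Both gaps are positive, and one is 1 exactly when the other is; so they are both 1 or both
     larger. *)
  have [lt_ab succ_ab] := child_rel aK bK.
  move: ab (ab) succ_ab; rewrite {1}lt_ab /=; lia.
Qed.

Lemma state_to_tree : tree_equiv (canonical_tree M1) (canonical_tree M2).
Proof.
exists f; split.
- move=> p q; rewrite !canonical_pids // => pK qK.
  rewrite !relpath_canonical // -f_ranks //; split=> [->//|].
  by apply: (ranks_inj K2_nil K2_closed); rewrite ?f_node.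
- split.
  + by move=> p; rewrite /= !canonical_pids //; apply: f_node.
  + by move=> p q /set_mem /= + /set_mem /=; rewrite !canonical_pids //; apply: f_inj.
  + move=> q /=; rewrite canonical_pids // => /f_surj[p pK <-].
    by exists p; rewrite //= canonical_pids.
- move=> p t t' /in_subtrees_canonical[//|//|-> pK].
  by case/in_subtrees_canonical=> // -> _; apply: f_node_equiv.
Qed.

End StateToTree.

Lemma canonical_equiv :
  tree_equiv (canonical_tree M1) (canonical_tree M2) <-> state_equiv M1 M2.
Proof.
split=> [[f f_equiv]|[h h_equiv]]; last exact: state_to_tree h_equiv.
by exists f; apply: tree_to_state.
Qed.

End Equivalence.

Theorem theorem3 (O : choiceType) (V : eqType) (N : tnet O V)
    (M1 M2 : marking N) (R1 R2 : tree (marking N)) :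
  reachable M1 -> reachable M2 -> clean M1 -> clean M2 ->
  representation M1 R1 -> representation M2 R2 ->
  (tree_equiv R1 R2 <-> state_equiv M1 M2).
Proof.
move=> /reachable_inv inv1 /reachable_inv inv2 clean1 clean2.
move=> /(representation_canonical inv1 clean1) ->.
move=> /(representation_canonical inv2 clean2) ->.
exact: canonical_equiv.
Qed.
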